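(* The function $\tau_{\vec{m},\vec{n}}^E(t,s)=\tau_{\vec m,\vec n}^E(t,s;\alpha,\beta;a,b)$ satisfies the following Virasoro constraints: $$\mathcal{B}_k\,\tau_{\vec{m},\vec{n}}^E=\mathbb{V}_k^{\vec{m},\vec{n}}\,\tau_{\vec{m},\vec{n}}^E,\qquad k\geq-1,$$ with $$\mathcal{B}_k=\sum_{i=1}^{2r}c_i^{k+1}\,\frac{\partial}{\partial c_i},\qquad E=\bigcup_{i=1}^{r}[c_{2i-1},c_{2i}]\subset\mathbb{R},$$ and $$\mathbb{V}_k^{\vec{m},\vec{n}}=\sum_{i=1}^{q}\Big[\mathbb{J}_{k,m_i}^{(2)}(-s^{(i)})+a_i\,\mathbb{J}_{k+1,m_i}^{(1)}(-s^{(i)})-(1-2\alpha_i)\,\mathbb{J}_{k+2,m_i}^{(1)}(-s^{(i)})\Big]+\sum_{i=1}^{p}\Big[\mathbb{J}_{k,n_i}^{(2)}(t^{(i)})+b_i\,\mathbb{J}_{k+1,n_i}^{(1)}(t^{(i)})+2\beta_i\,\mathbb{J}_{k+2,n_i}^{(1)}(t^{(i)})-(k+1)\,\mathbb{J}_{k,n_i}^{(1)}(t^{(i)})\Big].$$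
   Context: Let $p,q\ge1$, let $\vec m=(m_1,\dots,m_q)$ and $\vec n=(n_1,\dots,n_p)$ be vectors of positive integers with $\sum_i m_i=\sum_j n_j=N$. Let $a_1,\dots,a_q,b_1,\dots,b_p,\alpha_1,\dots,\alpha_q,\beta_1,\dots,\beta_p$ be parameters with $\sum_{i}a_i=\sum_j b_j=\sum_i\alpha_i=\sum_j\beta_j=0$, and let $t^{(j)}=(t^{(j)}_1,t^{(j)}_2,\dots)$, $1\le j\le p$, and $s^{(i)}=(s^{(i)}_1,s^{(i)}_2,\dots)$, $1\le i\le q$, be (formal) time variables. Put $$\psi_i^{-s}(x)=e^{a_ix+\alpha_ix^2-\sum_{k\ge1}s_k^{(i)}x^k}\ (1\le i\le q),\qquad \varphi_j^{t}(x)=e^{b_jx+\beta_jx^2+\sum_{k\ge1}t_k^{(j)}x^k}\ (1\le j\le p).$$ Let $(\tilde\psi_1^{-s},\dots,\tilde\psi_N^{-s})$ be the list of functions $x^k\psi_i^{-s}(x)$, $0\le k\le m_i-1$, for $i=1,\dots,q$ successively, and $(\tilde\varphi_1^{t},\dots,\tilde\varphi_N^{t})$ the list $x^k\varphi_j^{t}(x)$, $0\le k\le n_j-1$, for $j=1,\dots,p$ successively. Define $$\tau_{\vec m,\vec n}^E(t,s;\alpha,\beta;a,b)=\frac1{N!}\int_{E^N}\Big(\prod_{i=1}^Ne^{-x_i^2/2}dx_i\Big)\det\big[\tilde\psi_i^{-s}(x_j)\big]_{1\le i,j\le N}\det\big[\tilde\varphi_i^{t}(x_j)\big]_{1\le i,j\le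 N}.$$ For a sequence of variables $t=(t_1,t_2,\dots)$, and integers $m,k$, define $$\mathbb{J}^{(1)}_{m,k}(t)=\frac{\partial}{\partial t_m}+(-m)t_{-m}+k\,\delta_{0,m},$$ $$\mathbb{J}^{(2)}_{m,k}(t)=\frac12\Big(\sum_{i+j=m}\frac{\partial^2}{\partial t_i\partial t_j}+2\sum_{i\ge1}it_i\frac{\partial}{\partial t_{i+m}}+\sum_{i+j=-m}it_i\,jt_j\Big)+\Big(k+\frac{m+1}2\Big)\Big(\frac{\partial}{\partial t_m}+(-m)t_{-m}\Big)+\frac{k(k+1)}2\delta_{m,0},$$ with the convention that $t_i=0$ and $\partial/\partial t_i=0$ whenever $i\le0$. The notation $\mathbb{J}(-s)$ means that $t_i$ is replaced by $-s_i$ and $\partial/\partial t_i$ by $-\partial/\partial s_i$. *)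

(* Defs.v *)
From HB Require Import structures.
From mathcomp Require Import all_boot all_order all_algebra.
From mathcomp Require Import all_classical all_reals all_analysis.

Set Implicit Arguments.
Unset Strict Implicit.
Unset Printing Implicit Defensive.

Import Order.TTheory GRing.Theory Num.Theory.
Import numFieldNormedType.Exports.

Local Open Scope classical_set_scope.
Local Open Scope ring_scope.

(* Conventions.  A sequence of times (u_1, u_2, ...) is a function
   u : nat -> R whose value at 0 is never used.  The end points c_1, c_2, ...
   are likewise c : nat -> R with only the indices 1, ..., 2r used. *)

(* d f / d u_i, the other coordinates being frozen *)
Definition partial (R : realType) (I : eqType) (i : I) (f : (I -> R) -> R)
    (u : I -> R) : R :=
  derive1 (fun h : R => f [eta u with i |-> h]) (u i).

(* Times for which the exponents of psi and phi are honest functions on R; all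
   finitely supported times qualify, so that an identity between functions
   smooth in the times contains the identity of formal power series. *)
Definition entire_times (R : realType) (u : nat -> R) : Prop :=
  forall x : R, cvgn (series (fun k => u k * x ^+ k)).

Definition potential (R : realType) (u : nat -> R) (x : R) : R :=
  \big[+%R/0]_(1 <= k <oo) (u k * x ^+ k).

Definition psi (R : realType) (a alpha : R) (s : nat -> R) (x : R) : R :=
  expR (a * x + alpha * x ^+ 2 - potential s x).

Definition phi (R : realType) (b beta : R) (t : nat -> R) (x : R) : R :=
  expR (b * x + beta * x ^+ 2 + potential t x).

Definition blocks (R : realType) (q : nat) (m : 'I_q -> nat)
    (f : 'I_q -> R -> R) : seq (R -> R) :=
  [seq (fun x : R => x ^+ k * f i x) | i <- enum 'I_q, k <- iota 0 (m i)].

(* det [l_i(x_j)] for a list l_0, l_1, ... of functions *)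
Definition det_at (R : realType) (N : nat) (l : seq (R -> R))
    (x : 'rV[R]_N) : R :=
  \det (\matrix_(i < N, j < N) nth (fun=> 0) l i (x 0 j)).

(* Integral over E^N, as an iterated Lebesgue integral *)
Fixpoint integral_pow (R : realType) (E : set R) (N : nat) :
    ('rV[R]_N -> R) -> R :=
  match N with
  | 0 => fun F => F 0
  | N'.+1 => fun F =>
      \int[@lebesgue_measure R]_(y in E)
        integral_pow E (fun x : 'rV[R]_N' => F (row_mx (y%:M : 'rV_1) x))
  end.

Definition intervals (R : realType) (r : nat) (c : nat -> R) : set R :=
  \bigcup_(i in [set i | (1 <= i <= r)%N]) [set` `[c (2 * i).-1%N, c (2 * i)%N]].

Definition tau (R : realType) (p q N : nat) (m : 'I_q -> nat) (n : 'I_p -> nat)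
    (a alpha : 'I_q -> R) (b beta : 'I_p -> R) (E : set R)
    (s : 'I_q -> nat -> R) (t : 'I_p -> nat -> R) : R :=
  (N`!%:R)^-1 *
  integral_pow E (fun x : 'rV[R]_N =>
    (\prod_(i < N) expR (- (x 0 i ^+ 2 / 2))) *
    det_at (blocks m (fun i => psi (a i) (alpha i) (s i))) x *
    det_at (blocks n (fun j => phi (b j) (beta j) (t j))) x).

(* Below, e = 1 gives the operators J(u) and e = -1 the operators J(-u): the
   variable u_i becomes e u_i and d/du_i becomes e d/du_i.  Both are 0 for
   i <= 0. *)
Definition tvar (R : realType) (e : R) (i : int) (u : nat -> R) : R :=
  if 0 < i then e * u `|i|%N else 0.

Definition tder (R : realType) (e : R) (i : int) (f : (nat -> R) -> R)
    (u : nat -> R) : R :=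
  if 0 < i then e * partial `|i|%N f u else 0.

Definition J1 (R : realType) (e : R) (m k : int) (f : (nat -> R) -> R)
    (u : nat -> R) : R :=
  tder e m f u + (- m)%:~R * tvar e (- m) u * f u + k%:~R * (m == 0)%:R * f u.

(* In the first and third lines i ranges over 1, ..., |m| - 1, which covers all
   pairs i, j >= 1 with i + j = m, resp. i + j = - m; the terms are 0 by the
   convention above when the sign of m is the wrong one. *)
Definition J2 (R : realType) (e : R) (m k : int) (f : (nat -> R) -> R)
    (u : nat -> R) : R :=
  2^-1 *
    (\sum_(1 <= i < `|m|%N) tder e i (tder e (m - i%:Z) f) u
     + 2 * \big[+%R/0]_(1 <= i <oo)
             (i%:R * tvar e i u * tder e (i%:Z + m) f u)
     + (\sum_(1 <= i < `|m|%N)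
          (i%:R * tvar e i u) * ((- m - i%:Z)%:~R * tvar e (- m - i%:Z) u))
       * f u)
  + (k%:~R + (m + 1)%:~R / 2)
      * (tder e m f u + (- m)%:~R * tvar e (- m) u * f u)
  + (k * (k + 1))%:~R / 2 * (m == 0)%:R * f u.

Definition boundary_op (R : realType) (r : nat) (k : int)
    (G : (nat -> R) -> R) (c : nat -> R) : R :=
  \sum_(1 <= i < (2 * r).+1) c i ^ (k + 1) * partial i G c.

Definition virasoro_op (R : realType) (p q : nat)
    (m : 'I_q -> nat) (n : 'I_p -> nat)
    (a alpha : 'I_q -> R) (b beta : 'I_p -> R) (k : int)
    (F : ('I_q -> nat -> R) -> ('I_p -> nat -> R) -> R)
    (s : 'I_q -> nat -> R) (t : 'I_p -> nat -> R) : R :=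
  \sum_(i < q)
     (let Fi u := F [eta s with i |-> u] t in
      J2 (-1) k (m i) Fi (s i)
      + a i * J1 (-1) (k + 1) (m i) Fi (s i)
      - (1 - 2 * alpha i) * J1 (-1) (k + 2) (m i) Fi (s i))
  + \sum_(i < p)
     (let Fi u := F s [eta t with i |-> u] in
      J2 1 k (n i) Fi (t i)
      + b i * J1 1 (k + 1) (n i) Fi (t i)
      + 2 * beta i * J1 1 (k + 2) (n i) Fi (t i)
      - (k + 1)%:~R * J1 1 k (n i) Fi (t i)).

(* Main.v *)
Require Import Defs.
From HB Require Import structures.
From mathcomp Require Import all_boot all_order all_algebra.
From mathcomp Require Import all_classical all_reals all_analysis.
From mathcomp Require Import perm measurable_realfun.
From mathcomp Require Import ring lra zify.

Set Implicit Arguments.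
Unset Strict Implicit.
Unset Printing Implicit Defensive.

Import Order.TTheory GRing.Theory Num.Theory.
Import numFieldNormedType.Exports.

Local Open Scope classical_set_scope.
Local Open Scope ring_scope.

(* By Andreief's identity tau is the determinant of the one-variable moments
   mu(e_x + f_y), where mu(l) is the integral over E of x^l psi_i phi_j
   exp(-x^2/2) and e_x, f_y are the exponents attached to row x and column y, so
   no integration by parts in several variables is needed.  A time derivative
   d/dt_n of block i raises, in turn, the exponent of each row (or column) of
   that block by n.  The boundary operator replaces a moment by the integral of
   the derivative of x^(k+1+l) psi_i phi_j exp(-x^2/2), which is a combination
   of moments; its terms split into row terms and column terms, and match the
   first-order part of the Virasoro operator.  The second-order part
   contributes determinants in which two rows a, b of one block, e_a < e_b, are
   raised by u and k - u; exchanging the exponents of the two rows changes the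
   sign, so that for fixed a, b all of them cancel or vanish except the one with
   u = 0. *)

(** * Determinants with shifted exponents *)

(** The differential of the determinant at [A] in the direction [B], by Jacobi's formula. *)
Definition det_deriv (R : comNzRingType) (N : nat) (A B : 'M[R]_N) : R :=
  \sum_a \sum_b B a b * cofactor A a b.

(** The cofactors along row [a] do not involve row [a], so the Laplace expansion of [B] may use
    those of [A]. *)
Lemma det_row_subst (R : comNzRingType) (N : nat) (A B : 'M[R]_N) (a : 'I_N) :
  (forall i j, i != a -> B i j = A i j) ->
  \det B = \sum_b B a b * cofactor A a b.
Proof.
move=> BA; rewrite (expand_det_row _ a); apply: eq_bigr => b _; congr (_ * _).
rewrite /cofactor; congr (_ * \det _).
by apply/matrixP => i j; rewrite !mxE BA // eq_sym neq_lift.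
Qed.

Definition set_exp (N : nat) (a : 'I_N) (v : nat) (e : 'I_N -> nat) : 'I_N -> nat :=
  [eta e with a |-> v].

Definition shift_exp (N : nat) (a : 'I_N) (n : nat) (e : 'I_N -> nat) : 'I_N -> nat :=
  set_exp a (e a + n) e.

(** A row enters only through its label and its exponent: raising exponents stays within this family
    of determinants, and two rows with the same label and exponent coincide. *)
Definition exp_det (R : comNzRingType) (N : nat) (L : Type) (lab : 'I_N -> L)
    (G : L -> nat -> 'I_N -> R) (e : 'I_N -> nat) : R :=
  \det (\matrix_(a, b) G (lab a) (e a) b).

Section ExpDet.
Variables (R : numFieldType) (N : nat) (L : eqType) (lab : 'I_N -> L).
Variable G : L -> nat -> 'I_N -> R.
Implicit Types (e : 'I_N -> nat) (a b : 'I_N).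
Local Notation W := (exp_det lab G).

Lemma shift_expC a b u v e :
  shift_exp a u (shift_exp b v e) = shift_exp b v (shift_exp a u e).
Proof.
apply/funext => c; rewrite /shift_exp /set_exp /= (eq_sym b a).
case: (eqVneq a b) => [->|ab]; first by case: eqP => // _; rewrite addnAC.
by case: (eqVneq c a) => [->|//]; rewrite (negPf ab).
Qed.

Lemma shift_exp0 a e : shift_exp a 0 e = e.
Proof.
apply/funext => c; rewrite /shift_exp /set_exp /=.
by case: eqP => [->|//]; rewrite addn0.
Qed.

Lemma shift_expD a u v e : shift_exp a u (shift_exp a v e) = shift_exp a (u + v) e.
Proof.
by apply/funext => c; rewrite /shift_exp /set_exp /= eqxx; case: eqP => //; lia.
Qed.

Lemma exp_det_set a v e :
  W (set_exp a v e) =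
  \sum_b G (lab a) v b * cofactor (\matrix_(a, b) G (lab a) (e a) b) a b.
Proof.
rewrite /exp_det (@det_row_subst _ _ (\matrix_(a, b) G (lab a) (e a) b) _ a).
  by apply: eq_bigr => b _; rewrite mxE /set_exp /= eqxx.
by move=> i j ia; rewrite !mxE /set_exp /= (negPf ia).
Qed.

Lemma exp_det_eq0 a b e : lab a = lab b -> a != b -> e a = e b -> W e = 0.
Proof.
move=> lab_ab ab e_ab; apply: (determinant_alternate ab) => j.
by rewrite !mxE lab_ab e_ab.
Qed.

Lemma exp_det_swap a b e e' : lab a = lab b -> a != b ->
  e' a = e b -> e' b = e a -> (forall c, c != a -> c != b -> e' c = e c) ->
  W e' = - W e.
Proof.
move=> lab_ab ab ea eb ec.
rewrite /exp_det -[X in - X]mul1r -mulNr.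
have -> : -1 = (-1) ^+ (tperm a b) :> R by rewrite odd_tperm ab expr1.
rewrite -det_perm -det_mulmx -row_permE; congr (\det _).
apply/matrixP => c j; rewrite !mxE.
case: (eqVneq c a) => [->|ca]; first by rewrite tpermL ea lab_ab.
case: (eqVneq c b) => [->|cb]; first by rewrite tpermR eb lab_ab.
by rewrite tpermD 1?eq_sym // ec.
Qed.

(** With [d = e b - e a], the terms [0 < u < d] have two equal rows and the terms [d <= u <= k]
    cancel in pairs, which leaves [u = 0]. The last hypothesis says that the block has no gap below
    [e b]; it provides the equal rows. *)
Lemma exp_det_pair a b e k : lab a = lab b -> (e a < e b)%N ->
  (forall v, (v < e b)%N -> exists2 c, lab c = lab b & e c = v) ->
  \sum_(0 <= u < k.+1) W (shift_exp a u (shift_exp b (k - u) e)) =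
  W (shift_exp b k e).
Proof.
move=> lab_ab e_ab full.
have ab : a != b by apply: contraTneq e_ab => ->; rewrite ltnn.
have ba : b != a by rewrite eq_sym.
rewrite big_nat_recl //= shift_exp0 subn0 -[RHS]addr0; congr (_ + _).
pose F u := W (shift_exp a u (shift_exp b (k - u) e)).
pose d := (e b - e a)%N.
(* For 0 < u < d the raised row a equals the row of exponent e a + u. *)
have F0 u : (0 < u < d)%N -> F u = 0.
  move=> /andP[u0 ud]; have [|c lab_c e_c] := full (e a + u)%N.
    by rewrite /d in ud; lia.
  have ca : a != c by apply/eqP => ca; rewrite -ca in e_c; lia.
  have cb : c != b by apply/eqP => cb; rewrite cb /d in e_c ud; lia.
  apply: (@exp_det_eq0 a c) => //; first by rewrite lab_c.
  rewrite /shift_exp /set_exp /= eqxx (negPf ab) eq_sym (negPf ca).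
  by rewrite (negPf cb).
(* The two raised exponents are [e a + u] and [e b + k - u]; the involution [u -> k + d - u] of
   [[d, k]] exchanges them. *)
have Fswap u : (d <= u <= k)%N -> F (k + d - u)%N = - F u.
  move=> /andP[du uk]; apply: (@exp_det_swap a b) => //.
  - by rewrite /shift_exp /set_exp /= !eqxx (negPf ab) (negPf ba) /d; lia.
  - rewrite /shift_exp /set_exp /= !eqxx (negPf ab) (negPf ba).
    by rewrite /d in du *; lia.
  - by move=> c ca cb; rewrite /shift_exp /set_exp /= (negPf ca) (negPf cb).
rewrite -(big_add1 _ _ 0 k.+1 xpredT F).
have [kd|dk] := ltnP k d.
  by rewrite big_nat big1 // => u /andP[u0 uk]; apply: F0; lia.
rewrite (@big_cat_nat _ _ _ d) //=; [|rewrite /d; lia|lia].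
rewrite big_nat big1 ?add0r; last by move=> u; apply: F0.
(* Reversing the order of summation is exactly the involution of [Fswap]. *)
set S := bigop _ _ _; have : S = - S.
  rewrite {1}/S big_nat_rev /= /S big_nat [in RHS]big_nat -sumrN.
  by apply: eq_bigr => u /andP[du uk]; rewrite -Fswap; [congr F|]; lia.
by move/eqP; rewrite -subr_eq0 opprK -mulr2n mulrn_eq0 /= => /eqP.
Qed.

End ExpDet.

(** * Sums over the rows of one block, whose exponents are 0, ..., m - 1 *)

Section Block.
Variables (R : numFieldType) (N : nat) (L : eqType) (lab : 'I_N -> L).
Variable G : L -> nat -> 'I_N -> R.
Variables (e : 'I_N -> nat) (i : L) (m : nat) (row : 'I_m -> 'I_N).
Hypothesis lab_row : forall v, lab (row v) = i.
Hypothesis exp_row : forall v, e (row v) = v.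
Hypothesis row_onto : forall a, lab a = i -> exists v, a = row v.
Local Notation W := (exp_det lab G).

(** On the block, [e] inverts [row]; this gives the partial inverse used to reindex. *)
Lemma sum_block (F : 'I_N -> R) :
  \sum_(a | lab a == i) F a = \sum_(v < m) F (row v).
Proof.
rewrite (reindex_omap row (fun a => insub (e a))) => [|a /eqP/row_onto[v ->]].
  apply: eq_bigl => v; rewrite lab_row eqxx exp_row insubT //=.
  by move=> vm; apply/eqP; congr Some; apply: val_inj.
by rewrite exp_row insubT //= => vm; congr Some; congr row; apply: val_inj.
Qed.

Let pairs k v w := \sum_(0 <= u < k.+1)
  W (shift_exp (row v) u (shift_exp (row w) (k - u) e)).

Let pairs_lt k (v w : 'I_m) : (v < w)%N ->
  pairs k v w = W (shift_exp (row w) k e).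
Proof.
move=> vw; apply: exp_det_pair; rewrite ?lab_row ?exp_row // => x xw.
by exists (row (Ordinal (ltn_trans xw (ltn_ord w)))).
Qed.

Let pairsC k v w : pairs k v w = pairs k w v.
Proof.
rewrite /pairs big_nat_rev /= add0n big_nat [in RHS]big_nat.
apply: eq_bigr => u /andP[_ uk]; rewrite shift_expC subSS subKn //.
Qed.

(** By [pairs_lt] each pair contributes one shift of its row of larger exponent. Row [v] is the
    larger one in [v] pairs, and the symmetry [pairsC] doubles the total. *)
Lemma sum_block_pairs k :
  \sum_(v < m) \sum_(w < m | w != v) pairs k v w =
  2 * \sum_(v < m) (v : nat)%:R * W (shift_exp (row v) k e).
Proof.
have half : \sum_(v < m) \sum_(w < m | (w < v)%N) pairs k v w =
    \sum_(v < m) (v : nat)%:R * W (shift_exp (row v) k e).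
  apply: eq_bigr => v _.
  under eq_bigr do rewrite pairsC pairs_lt //.
  rewrite -(big_ord_widen _ (fun=> W (shift_exp (row v) k e))) ?sumr_const //.
    by rewrite card_ord mulr_natl.
  exact: ltnW.
have split_ne v : \sum_(w < m | w != v) pairs k v w =
    \sum_(w < m | (w < v)%N) pairs k v w + \sum_(w < m | (v < w)%N) pairs k w v.
  rewrite (bigID (fun w : 'I_m => (w < v)%N)) /=; congr (_ + _).
    by apply: eq_bigl => w; rewrite -val_eqE /=; lia.
  under [RHS]eq_bigr do rewrite pairsC.
  by apply: eq_bigl => w; rewrite -val_eqE /=; lia.
under eq_bigr do rewrite split_ne.
rewrite big_split /= half (exchange_big_dep xpredT) //= half.
by rewrite mulr2n mulrDl mul1r.
Qed.

(** The diagonal [a = b] gives [k - 1] copies of the sum of single shifts. Off the diagonal,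
    [sum_block_pairs] applies after the end values [u = 0] and [u = k] are added, at the cost of
    [2 (m - 1)] copies; and [k - 1 - 2 (m - 1) = k + 1 - 2 m]. *)
Lemma sum_block_double_shift k : (0 < k)%N ->
  \sum_(1 <= u < k) \sum_(a | lab a == i) \sum_(b | lab b == i)
     W (shift_exp a u (shift_exp b (k - u) e)) =
  2 * \sum_(a | lab a == i) (e a)%:R * W (shift_exp a k e)
  + (k%:R + 1 - 2 * m%:R) * \sum_(a | lab a == i) W (shift_exp a k e).
Proof.
case: k => // k _.
rewrite !sum_block; under [in RHS]eq_bigr do rewrite exp_row.
rewrite -sum_block_pairs.
under eq_bigr => u _ do rewrite sum_block.
under eq_bigr => u _ do under eq_bigr => v _ do rewrite sum_block (bigD1 v) //=.
under eq_bigr => u _ do rewrite big_split /=.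
rewrite big_split /= big_nat.
under eq_bigr => u /andP[_ uk] do
  under eq_bigr => v _ do rewrite shift_expD subnKC 1?ltnW //.
rewrite -big_nat sumr_const_nat.
set S := \sum_(v < m) W _.
(* At each end value of [u] only one of the two rows is raised, and each row is the raised one for
   [m - 1] choices of the other. *)
have -> : \sum_(v < m) \sum_(w < m | w != v) pairs k.+1 v w =
  \sum_(1 <= u < k.+1) \sum_(v < m) \sum_(w < m | w != v)
    W (shift_exp (row v) u (shift_exp (row w) (k.+1 - u) e)) + 2 * (m%:R - 1) * S.
  have cst (F : 'I_m -> R) :
      \sum_(v < m) \sum_(w < m | w != v) F v = (m%:R - 1) * \sum_(v < m) F v.
    rewrite mulr_sumr; apply: eq_bigr => v _.
    rewrite sumr_const cardC1 card_ord -[LHS]mulr_natl; congr (_ * _).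
    by rewrite -subn1 natrB // (leq_ltn_trans _ (ltn_ord v)).
  rewrite [X in _ = X + _]exchange_big /=.
  under [X in _ = X + _]eq_bigr => v _ do rewrite exchange_big /=.
  rewrite -mulrA mulr2n mulrDl mul1r -{1}cst -cst.
  rewrite [X in _ = _ + (_ + X)](exchange_big_dep xpredT) //= -!big_split /=.
  apply: eq_bigr => v _; under [in X in _ = _ + (_ + X)]eq_bigl do rewrite eq_sym.
  rewrite -!big_split /=; apply: eq_bigr => w _.
  rewrite /pairs big_nat_recr //= big_nat_recl //= subn0 subnn !shift_exp0.
  by rewrite big_add1 addrAC addrA [RHS]addrC addrA; ring.
rewrite -mulr_natl subSS subn0.
by ring.
Qed.

(** This is the sum [0 + ... + (m - 1)], read off from [sum_block_pairs] at [k = 0], where every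
    pair contributes [W e]. *)
Lemma sum_block_exp :
  2 * \sum_(a | lab a == i) (e a)%:R * W e = m%:R * (m%:R - 1) * W e.
Proof.
rewrite sum_block; under eq_bigr => v _ do rewrite exp_row -{1}(shift_exp0 (row v) e).
rewrite -sum_block_pairs.
under eq_bigr => v _ do under eq_bigr => w _ do
  rewrite /pairs big_nat1 !shift_exp0.
under eq_bigr => v _ do rewrite sumr_const cardC1 card_ord.
rewrite sumr_const card_ord.
have [->|m0] := posnP m; first by rewrite mulr0n !mul0r.
by rewrite -mulrnA -[LHS]mulr_natl natrM -subn1 natrB //; ring.
Qed.

End Block.

(** * Times and potentials *)

Lemma series_delta (R : realType) (n : nat) (v : R) (N : nat) : (n < N)%N ->
  \sum_(0 <= k < N) (if k == n then v else 0) = v.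
Proof.
move=> nN; rewrite -big_mkcond big_mkord (big_pred1 (Ordinal nN)) //.
Qed.

(** Beyond index [n], the new and old partial sums differ by the constant [(h - u n) * x ^+ n]. *)
Lemma cvg_sum_update (R : realType) (u : nat -> R) (n : nat) (h x : R) :
  entire_times u ->
  \sum_(0 <= k < N) [eta u with n |-> h] k * x ^+ k @[N --> \oo] -->
  limn (series (fun k => u k * x ^+ k)) + (h - u n) * x ^+ n.
Proof.
move=> /(_ x) cu.
rewrite (_ : (fun N => _) = (fun N => series (fun k => u k * x ^+ k) N +
   \sum_(0 <= k < N) (if k == n then (h - u n) * x ^+ n else 0))); last first.
  apply/funext => N; rewrite /series /= -big_split /=; apply: eq_bigr => k _.
  by case: eqP => [->|_]; [ring|rewrite addr0].
apply: cvgD => //; apply: cvg_near_cst.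
by exists n.+1 => // N /= nN; rewrite series_delta.
Qed.

Arguments cvg_sum_update {R u} n h x _.

Lemma entire_times_update (R : realType) (u : nat -> R) (n : nat) (h : R) :
  entire_times u -> entire_times [eta u with n |-> h].
Proof.
by move=> eu x; apply/cvg_ex; eexists; apply: cvg_sum_update.
Qed.

(** [potential] starts at index 1 but the power series at index 0, whence the correction [u 0]. *)
Lemma potential_limE (R : realType) (u : nat -> R) (x : R) :
  entire_times u ->
  potential u x = limn (series (fun k => u k * x ^+ k)) - u 0.
Proof.
move=> eu; rewrite /potential; apply/cvg_lim => //.
rewrite -cvg_shiftS.
rewrite (_ : (fun N => _) = (fun N => series (fun k => u k * x ^+ k) N.+1 - u 0)).
  apply: cvgB; last exact: cvg_cst.
  by rewrite cvg_shiftS; exact: eu.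
apply/funext => N; rewrite /series /= big_add1 /= [in RHS]big_nat_recl //=.
rewrite expr0 mulr1 addrAC subrr add0r.
by [].
Qed.

Lemma potential_update (R : realType) (u : nat -> R) (n : nat) (h x : R) :
  (0 < n)%N -> entire_times u ->
  potential [eta u with n |-> h] x = potential u x + (h - u n) * x ^+ n.
Proof.
move=> n0 eu; rewrite !potential_limE //; last exact: entire_times_update.
rewrite /= ltn_eqF //.
by rewrite (cvg_lim _ (cvg_sum_update n h x eu)) // addrAC.
Qed.

Lemma entire_times_diffs (R : realType) (u : nat -> R) :
  entire_times u -> entire_times (pseries_diffs u).
Proof.
(* Comparison point for the differentiated series: the factor 2 absorbs the coefficient, as
   [i + 1 <= 2 ^ (i + 1)], and [|x| + 1 >= 1] absorbs the extra power. *)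
move=> eu x; pose y := 2 * (`|x| + 1).
have y0 : 0 <= y by rewrite mulr_ge0 // addr_ge0.
have cy : cvgn (pseries (fun i => `|u i|) y).
  apply: (@is_cvg_pseries_inside_norm _ _ (y + 1)); first exact: eu.
  by rewrite !ger0_norm ?addr_ge0 // ltrDl.
apply: normed_cvg.
apply: (@series_le_cvg _ _ (fun i => `|u i.+1| * y ^+ i.+1)) => [i|i|i|].
- exact: normr_ge0.
- by apply: mulr_ge0 => //; exact: exprn_ge0.
- rewrite /= /pseries_diffs !normrM normrX (ger0_norm (ler0n _ _)).
  rewrite [_%:R * _]mulrC -mulrA ler_wpM2l // /y exprMn.
  apply: ler_pM => //.
    by rewrite -natrX ler_nat ltnW // ltn_expl.
  rewrite (@le_trans _ _ ((`|x| + 1) ^+ i)) //.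
    by rewrite lerXn2r // ?nnegrE ?addr_ge0 // lerDl.
  by rewrite exprS ler_peMl ?exprn_ge0 ?addr_ge0 // lerDr.
rewrite (_ : series _ = (fun n => pseries (fun i => `|u i|) y n.+1 - `|u 0|)).
  apply: is_cvgB; last exact: is_cvg_cst.
  by apply/cvg_ex; exists (limn (pseries (fun i => `|u i|) y)); rewrite cvg_shiftS.
apply/funext => n; rewrite /pseries /series /= [in RHS]big_nat_recl //=.
by rewrite expr0 mulr1 addrAC subrr add0r.
Qed.

Definition potential_deriv (R : realType) (u : nat -> R) (x : R) : R :=
  limn (pseries (pseries_diffs u) x).

Lemma is_derive_pseries (R : realType) (u : nat -> R) (x : R) :
  entire_times u ->
  is_derive x (1 : R) (fun x => limn (pseries u x)) (potential_deriv u x).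
Proof.
move=> eu; apply: (@pseries_snd_diffs _ _ (`|x| + 1)).
- exact: eu.
- exact: entire_times_diffs.
- by apply: entire_times_diffs; exact: entire_times_diffs.
- by rewrite [ltRHS]ger0_norm ?addr_ge0 // ltrDl.
Qed.

Lemma is_derive_continuous (R : realType) (f df : R -> R) :
  (forall x : R, is_derive x (1 : R) f (df x)) -> continuous f.
Proof.
move=> fdf x; apply/differentiable_continuous/derivable1_diffP.
by have [] := fdf x.
Qed.

Lemma continuous_potential_deriv (R : realType) (u : nat -> R) :
  entire_times u -> continuous (potential_deriv u).
Proof.
move=> eu; apply: is_derive_continuous => x.
by apply: is_derive_pseries; exact: entire_times_diffs.
Qed.

Lemma is_derive_potential (R : realType) (u : nat -> R) (x : R) :
  entire_times u -> is_derive x (1 : R) (potential u) (potential_deriv u x).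
Proof.
move=> eu.
rewrite (_ : potential u = (fun x => limn (pseries u x)) - cst (u 0)).
  rewrite -[potential_deriv u x]subr0; apply: is_deriveB.
  exact: is_derive_pseries.
by apply/funext => y; rewrite potential_limE.
Qed.

Lemma potential_deriv_sumE (R : realType) (u : nat -> R) (x : R) n :
  \sum_(1 <= l < n.+1) l%:R * u l * x ^+ l.-1 = pseries (pseries_diffs u) x n.
Proof. by rewrite big_add1. Qed.

Lemma cvg_potential_deriv (R : realType) (u : nat -> R) (x : R) :
  entire_times u ->
  \sum_(1 <= l < n) l%:R * u l * x ^+ l.-1 @[n --> \oo] --> potential_deriv u x.
Proof.
move=> eu; rewrite -cvg_shiftS /=.
under eq_fun do rewrite potential_deriv_sumE.
exact: entire_times_diffs.
Qed.

(** The bound is uniform in [x] and [n], as dominated convergence requires: it is the sum at [K] of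
    the series of absolute values. *)
Lemma potential_deriv_bound (R : realType) (u : nat -> R) (K : R) :
  0 <= K -> entire_times u ->
  exists C, forall x n, `|x| <= K ->
    `|\sum_(1 <= l < n) l%:R * u l * x ^+ l.-1| <= C.
Proof.
move=> K0 eu.
pose v i := `|pseries_diffs u i|.
have cv : cvgn (pseries v K).
  apply: (@is_cvg_pseries_inside_norm _ _ (K + 1)).
    exact: entire_times_diffs.
  by rewrite !ger0_norm ?addr_ge0 // ltrDl.
exists (limn (pseries v K)) => x [|n] xK.
  rewrite big_geq // normr0; apply: limr_ge => //.
  by apply: nearW => n; apply: sumr_ge0 => i _; rewrite mulr_ge0 ?exprn_ge0 ?normr_ge0.
rewrite potential_deriv_sumE; apply: (@le_trans _ _ (pseries v K n)).
  rewrite /pseries /series /= (le_trans (ler_norm_sum _ _ _)) // ler_sum // => i _.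
  by rewrite normrM normrX ler_wpM2l // lerXn2r // nnegrE.
apply: nondecreasing_cvgn_le => //; apply: nondecreasing_series => i _ _.
by rewrite mulr_ge0 ?exprn_ge0 ?normr_ge0.
Qed.

Lemma continuous_mulfun (R : realType) (f g : R -> R) :
  continuous f -> continuous g -> continuous (fun x => f x * g x).
Proof. by move=> cf cg x; apply: continuousM; [exact: cf|exact: cg]. Qed.

Lemma continuous_addfun (R : realType) (f g : R -> R) :
  continuous f -> continuous g -> continuous (fun x => f x + g x).
Proof. by move=> cf cg x; apply: continuousD; [exact: cf|exact: cg]. Qed.

Lemma continuous_subfun (R : realType) (f g : R -> R) :
  continuous f -> continuous g -> continuous (fun x => f x - g x).
Proof. by move=> cf cg x; apply: continuousB; [exact: cf|exact: cg]. Qed.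

Lemma continuous_monomial (R : realType) (c : R) (l : nat) :
  continuous (fun x : R => c * x ^+ l).
Proof.
by apply: continuous_mulfun => x; [exact: cst_continuous|exact: exprn_continuous].
Qed.

(** * Integrals of continuous functions over a compact set *)

Section Integral.
Variables (R : realType) (E : set R).
Hypothesis compact_E : compact E.
Implicit Types f g : R -> R.
Local Notation mu := (@lebesgue_measure R).

Let measurable_E : measurable E.
Proof. exact: compact_measurable. Qed.

Lemma integrable_continuous f : continuous f -> mu.-integrable E (EFin \o f).
Proof.
move=> cf; apply: continuous_compact_integrable => //.
exact: continuous_subspaceT.
Qed.

Lemma continuous_bigsum (I : Type) (s : seq I) (F : I -> R -> R) :
  (forall i, continuous (F i)) -> continuous (fun x => \sum_(i <- s) F i x).
Proof.
move=> cF; elim: s => [|i s IH] x.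
  under eq_fun do rewrite big_nil. exact: cst_continuous.
under eq_fun do rewrite big_cons. apply: continuousD; [exact: cF|exact: IH].
Qed.

Lemma Rintegral_bigsum (I : Type) (s : seq I) (F : I -> R -> R) :
  (forall i, continuous (F i)) ->
  \int[mu]_(x in E) (\sum_(i <- s) F i x) = \sum_(i <- s) \int[mu]_(x in E) F i x.
Proof.
move=> cF; elim: s => [|i s IH].
  by rewrite big_nil; under eq_Rintegral do rewrite big_nil; rewrite Rintegral_cst ?mul0r.
rewrite big_cons -IH -RintegralD //; first last.
- by apply: integrable_continuous; exact: continuous_bigsum.
- exact: integrable_continuous.
by apply: eq_Rintegral => x _; rewrite big_cons.
Qed.

Lemma bounded_E : exists2 K : R, 0 <= K & forall x, E x -> `|x| <= K.
Proof.
have [M [_ ME]] := compact_bounded compact_E.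
exists (`|M| + 1) => [|x Ex]; first by rewrite addr_ge0.
by apply: ME => //; rewrite (le_lt_trans (ler_norm M)) // ltrDl.
Qed.

(** Dominated convergence with majorant [C * |g|]. It evaluates the infinite first-order sum of [J2]
    on moments. *)
Lemma cvg_Rintegral_potential_deriv (u : nat -> R) g :
  entire_times u -> continuous g ->
  \sum_(1 <= l < n) l%:R * u l * \int[mu]_(x in E) (x ^+ l.-1 * g x) @[n --> \oo]
  --> \int[mu]_(x in E) (potential_deriv u x * g x).
Proof.
move=> eu cg; have [K K0 EK] := bounded_E.
have [C HC] := potential_deriv_bound K0 eu.
have cmono l : continuous (fun x : R => x ^+ l * g x).
  by apply: continuous_mulfun => //; exact: exprn_continuous.
pose F n x := (\sum_(1 <= l < n) l%:R * u l * x ^+ l.-1) * g x.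
have cF n : continuous (F n).
  apply: continuous_mulfun => //.
  by apply: continuous_bigsum => l; exact: continuous_monomial.
have cf : continuous (fun x => potential_deriv u x * g x).
  by apply: continuous_mulfun => //; exact: continuous_potential_deriv.
have -> : (fun n => \sum_(1 <= l < n) l%:R * u l * \int[mu]_(x in E) (x ^+ l.-1 * g x))
    = (fun n => \int[mu]_(x in E) F n x).
  apply/funext => n; rewrite /F.
  under [RHS]eq_Rintegral do rewrite mulr_suml.
  rewrite Rintegral_bigsum.
    apply: eq_bigr => l _; rewrite -RintegralZl //; last exact: integrable_continuous.
    by apply: eq_Rintegral => x _; rewrite mulrA.
  by move=> l; apply: continuous_mulfun => //; exact: continuous_monomial.
have cbound : continuous (fun x => C * `|g x|).
  apply: continuous_mulfun => x; first exact: cst_continuous.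
  exact: (continuous_comp (cg x) (@norm_continuous _ R^o (g x))).
have DC := @dominated_convergence _ _ R mu E measurable_E
  (fun n x => (F n x)%:E) (fun x => (potential_deriv u x * g x)%:E)
  (fun x => (C * `|g x|)%:E)
  (fun n => measurable_int _ (integrable_continuous (cF n)))
  (measurable_int _ (integrable_continuous cf)).
have cvgF : {ae mu, forall x, E x ->
    (F n x)%:E @[n --> \oo] --> (potential_deriv u x * g x)%:E}.
  apply: aeW => x Ex; apply: cvg_EFin; first exact: nearW.
  by apply: cvgM; [exact: cvg_potential_deriv|exact: cvg_cst].
have Fbound : {ae mu, forall x n, E x -> (`|(F n x)%:E| <= (C * `|g x|)%:E)%E}.
  apply: aeW => x n Ex; rewrite /= lee_fin /F normrM ler_wpM2r //.
  by apply: HC; exact: EK.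
have [_ _ /=] := DC cvgF (integrable_continuous cbound) Fbound.
rewrite -(@fineK _ (\int[mu]_(x in E) (potential_deriv u x * g x)%:E)%E); last first.
  exact: integrable_fin_num (integrable_continuous cf).
by move=> /fine_cvg.
Qed.

End Integral.

(** * Integrals over unions of intervals *)

(** Moving one time from [h0] to [h] multiplies the integrand by this exponential, with [d = 1] or
    [d = -1]; hence time derivatives of moments are higher moments. *)
Lemma is_derive_Rintegral_expR (R : realType) (E : set R) (g : R -> R) (d h0 : R)
    (n : nat) :
  compact E -> continuous g ->
  is_derive h0 (1 : R)
    (fun h => \int[@lebesgue_measure R]_(x in E) (expR (d * (h - h0) * x ^+ n) * g x))
    (d * \int[@lebesgue_measure R]_(x in E) (x ^+ n * g x)).
Proof.
move=> cE cg.
have mE : measurable E by exact: compact_measurable.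
have [K K0 EK] := bounded_E cE.
pose f h x := expR (d * (h - h0) * x ^+ n) * g x.
have cf h : continuous (f h).
  apply: continuous_mulfun => // x.
  apply: continuous_comp; [exact: continuous_monomial|exact: continuous_expR].
have df h x : is_derive h (1 : R) (f ^~ x) (d * x ^+ n * f h x).
  pose L := (d * x ^+ n) \*: (id - cst h0) : R -> R.
  have dL : is_derive h (1 : R) L (d * x ^+ n).
    by apply: is_derive_eq; rewrite subr0 scaler1.
  have -> : f ^~ x = g x \*: (expR \o L).
    apply/funext => y /=; rewrite /f /L /= mulrC; congr (_ * expR _).
    by rewrite mulrAC.
  have Lh : L h = d * (h - h0) * x ^+ n by rewrite mulrAC.
  by apply: is_derive_eq; rewrite Lh /f /GRing.scale /=; ring.
(* For [|h - h0| < 1] and [|x| <= K], both the prefactor [d * x ^+ n] and the exponent are bounded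
   by [|d| * K ^+ n]. *)
pose C := `|d| * K ^+ n * expR (`|d| * K ^+ n).
have C0 : 0 <= C by rewrite /C !mulr_ge0 ?expR_ge0 ?exprn_ge0.
have cG : continuous (fun x => C * `|g x|).
  apply: continuous_mulfun => x; first exact: cst_continuous.
  exact: (continuous_comp (cg x) (@norm_continuous _ R^o (g x))).
have I0 : `]h0 - 1, h0 + 1[%classic h0 by rewrite /= in_itv /=; apply/andP; split; lra.
have bound h x : `]h0 - 1, h0 + 1[%classic h -> E x ->
    `|partial1of2 f h x| <= C * `|g x|.
  move=> /=; rewrite in_itv /= => /andP[h1 h2] Ex.
  rewrite partial1of2E derive_val /f /C mulrA normrM ler_wpM2r //.
  rewrite normrM (ger0_norm (expR_ge0 _)).
  have dK : `|d * x ^+ n| <= `|d| * K ^+ n.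
    rewrite normrM normrX ler_wpM2l // lerXn2r // ?nnegrE //.
    exact: EK.
  apply: ler_pM; rewrite ?expR_ge0 //.
  rewrite ler_expR (le_trans (ler_norm _)) // mulrAC normrM.
  rewrite (le_trans _ dK) // ler_piMr // ler_norml; apply/andP; split; lra.
have intf h : `]h0 - 1, h0 + 1[%classic h -> (@lebesgue_measure R).-integrable E (EFin \o f h).
  by move=> _; exact: integrable_continuous.
have derf h x : `]h0 - 1, h0 + 1[%classic h -> E x -> derivable (f ^~ x) h 1.
  by move=> _ _; have [] := df h x.
have G0 x : 0 <= C * `|g x| by rewrite mulr_ge0.
have iG := integrable_continuous cE cG.
have D := @derivable_under_integral R _ _ (@lebesgue_measure R) f E mE h0
  (h0 - 1) (h0 + 1) I0 intf derf _ G0 iG bound.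
apply: DeriveDef => //.
rewrite -derive1E (@differentiation_under_integral R _ _ (@lebesgue_measure R) f E
  mE h0 (h0 - 1) (h0 + 1) I0 intf derf _ G0 iG bound).
rewrite -RintegralZl //; last first.
  by apply: integrable_continuous => //; apply: continuous_mulfun => //; exact: exprn_continuous.
apply: eq_Rintegral => x _.
by rewrite partial1of2E derive_val /f subrr mulr0 mul0r expR0 mul1r mulrA.
Qed.

Lemma near_gt_lt (R : realType) (x y z : R) : y < x -> x < z ->
  \forall w \near x, y < w < z.
Proof.
move=> yx xz; have /near_in_itvoo : x \in `]y, z[ by rewrite in_itv /= yx xz.
by apply: filterS => w; rewrite in_itv.
Qed.

(** The base point [A] is meant to lie to the left of all end points, so that [F] has a two-sided
    derivative at each of them. *)
Lemma antiderivative (R : realType) (A : R) (f : R -> R) : continuous f ->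
  exists F : R -> R, forall x : R, A < x -> is_derive x (1 : R) F (f x).
Proof.
move=> cf; exists (fun x => \int[@lebesgue_measure R]_(t in `[A, x]) f t) => x Ax.
have xx1 : x < x + 1 by rewrite ltrDl.
have intf : (@lebesgue_measure R).-integrable `[A, x + 1] (EFin \o f).
  by apply: integrable_continuous => //; exact: segment_compact.
have [dF dFE] := continuous_FTC1_closed xx1 intf Ax (cf x).
rewrite derive1E in dFE.
exact: DeriveDef dF dFE.
Qed.

Lemma Rintegral_antiderivative (R : realType) (A a b : R) (f F : R -> R) :
  continuous f -> (forall x : R, A < x -> is_derive x (1 : R) F (f x)) ->
  A < a -> a < b ->
  \int[@lebesgue_measure R]_(x in `[a, b]) f x = F b - F a.
Proof.
move=> cf dF Aa ab; rewrite /Rintegral (@continuous_FTC2 _ f F) //.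
- exact: continuous_subspaceT.
- have cF x : A < x -> F @ x --> F x.
    move=> Ax; apply/differentiable_continuous/derivable1_diffP.
    by have [] := dF x Ax.
  split.
  + by move=> x; rewrite in_itv /= => /andP[ax _]; have [] := dF x (lt_trans Aa ax).
  + by apply: cvg_at_right_filter; exact: cF.
  + by apply: cvg_at_left_filter; apply: cF; exact: lt_trans ab.
- move=> x; rewrite in_itv /= => /andP[ax _].
  by rewrite derive1E; apply: derive_val; exact: dF (lt_trans Aa ax).
Qed.

Definition increasing_ends (R : realType) (r : nat) (c : nat -> R) : Prop :=
  forall i : nat, (1 <= i < 2 * r)%N -> c i < c i.+1.

Lemma increasing_ends_lt (R : realType) (r : nat) (c : nat -> R) (i j : nat) :
  increasing_ends r c -> (1 <= i)%N -> (i < j)%N -> (j <= 2 * r)%N -> c i < c j.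
Proof.
move=> hc i1; elim: j => // j IH; rewrite ltnS leq_eqVlt => /predU1P[<-|ij] jr.
  by apply: hc; rewrite i1.
by apply: lt_trans (IH ij (ltnW jr)) _; apply: hc; lia.
Qed.

Lemma intervals0 (R : realType) (c : nat -> R) : intervals 0 c = set0.
Proof. by rewrite /intervals bigcup0 // => i /=; lia. Qed.

Lemma intervalsS (R : realType) (r : nat) (c : nat -> R) :
  intervals r.+1 c = intervals r c `|` `[c (2 * r).+1, c (2 * r).+2]%classic.
Proof.
have e : (2 * r.+1 = (2 * r).+2)%N by lia.
apply/seteqP; split => x.
  move=> [i /= ir xi]; have [ir1|ir1] := eqVneq i r.+1.
    by right; move: xi; rewrite ir1 e.
  by left; exists i => //=; lia.
move=> [[i /= ir xi]|xr]; first by exists i => //=; lia.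
exists r.+1; first by rewrite /= leqnn.
by rewrite e.
Qed.

Lemma compact_intervals (R : realType) (r : nat) (c : nat -> R) :
  compact (intervals r c).
Proof.
elim: r => [|r IH]; first by rewrite intervals0; exact: compact0.
by rewrite intervalsS; apply: compactU => //; exact: segment_compact.
Qed.

(** Odd indices are left ends and even indices right ends, whence the sign. The intervals are
    disjoint because the ends increase strictly. *)
Lemma Rintegral_intervals (R : realType) (r : nat) (c : nat -> R) (A : R)
    (f F : R -> R) :
  increasing_ends r c -> continuous f -> (forall i, (1 <= i <= 2 * r)%N -> A < c i) ->
  (forall x : R, A < x -> is_derive x (1 : R) F (f x)) ->
  \int[@lebesgue_measure R]_(x in intervals r c) f x =
  \sum_(1 <= j < (2 * r).+1) (-1) ^+ j * F (c j).
Proof.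
move=> + cf + dF; elim: r => [|r IH] hc Ac.
  by rewrite intervals0 Rintegral_set0 big_geq.
rewrite intervalsS Rintegral_setU; first last.
- apply/disj_setPS => x [[i /= ir]]; rewrite !in_itv /= => /andP[_ xi] /andP[rx _].
  have := increasing_ends_lt (i := (2 * i)%N) (j := (2 * r).+1) hc.
  by rewrite ltNge (le_trans rx xi) => H; have := H ltac:(lia) ltac:(lia) ltac:(lia).
- rewrite -intervalsS; apply: integrable_continuous => //.
  exact: compact_intervals.
- exact: measurable_itv.
- by apply: compact_measurable; exact: compact_intervals.
rewrite IH; [|by move=> i ir; apply: hc; lia|by move=> i ir; apply: Ac; lia].
rewrite (_ : (2 * r.+1).+1 = (2 * r).+3)%N; last lia.
rewrite [in RHS]big_nat_recr //= [in RHS]big_nat_recr //=.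
rewrite -addrA; congr (_ + _).
rewrite (Rintegral_antiderivative cf dF); [|by apply: Ac; lia|by apply: hc; lia].
have s1 : (-1) ^+ (2 * r) = 1 :> R by rewrite -signr_odd mul2n odd_double.
by rewrite !exprS s1; ring.
Qed.

Lemma increasing_ends_update (R : realType) (r : nat) (c : nat -> R) (i : nat) :
  increasing_ends r c ->
  \forall h \near c i, increasing_ends r [eta c with i |-> h].
Proof.
move=> hc.
(* Only the comparisons of [c i] with its two neighbours can fail; a neighbour outside the range is
   replaced by an arbitrary bound at distance 1. *)
pose lo := if (1 <= i.-1 < 2 * r)%N then c i.-1 else c i - 1.
pose hi := if (1 <= i < 2 * r)%N then c i.+1 else c i + 1.
have loc : lo < c i.
  rewrite /lo; case: ifPn => [H|_]; last by rewrite ltrBlDr ltrDl.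
  by have := hc _ H; rewrite prednK //; lia.
have chi : c i < hi.
  by rewrite /hi; case: ifPn => [|_]; [exact: hc|rewrite ltrDl].
apply: (filterS _ (near_gt_lt loc chi)) => h /andP[loh hhi] j jr /=.
case: (eqVneq j i) => [ji|ji].
  by rewrite ji gtn_eqF //; move: hhi; rewrite /hi -ji jr.
case: (eqVneq j.+1 i) => [ji1|_]; last exact: hc.
by move: loh; rewrite /lo -ji1 /= jr.
Qed.

Lemma is_derive_Rintegral_intervals (R : realType) (r : nat) (c : nat -> R)
    (f : R -> R) (i : nat) :
  increasing_ends r c -> continuous f -> (1 <= i <= 2 * r)%N ->
  is_derive (c i) (1 : R)
    (fun h => \int[@lebesgue_measure R]_(x in intervals r [eta c with i |-> h]) f x)
    ((-1) ^+ i * f (c i)).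
Proof.
move=> hc cf ir; pose A := c 1%N - 1.
have Ac j : (1 <= j <= 2 * r)%N -> A < c j.
  move=> /andP[j1 jr]; rewrite /A ltrBlDr.
  have [<-|j1'] := eqVneq 1%N j; first by rewrite ltrDl.
  apply: ltr_wpDr => //; apply: (increasing_ends_lt hc) => //; lia.
have [F dF] := antiderivative A cf.
pose S := \sum_(1 <= j < (2 * r).+1 | j != i) (-1) ^+ j * F (c j).
(* For [h] near [c i] the ends are still increasing and above [A], so the integral is the
   alternating sum of values of [F], in which only the term of index [i] varies. *)
apply: (@near_eq_is_derive _ _ _ (cst S + (-1) ^+ i \*: F)); last first.
  have := dF (c i) (Ac i ir) => dFi.
  by apply: is_derive_eq; rewrite add0r.
have inc := increasing_ends_update i hc.
have lower : \forall h \near c i, A < h.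
  have ci1 : c i < c i + 1 by rewrite ltrDl.
  by apply: (filterS _ (near_gt_lt (Ac i ir) ci1)) => h /andP[].
near=> h.
have inc_h : increasing_ends r [eta c with i |-> h] by near: h.
rewrite (@Rintegral_intervals _ _ _ A _ F) //; last first.
  move=> j jr /=; case: eqP => _; last exact: Ac.
  by near: h.
rewrite (bigD1_seq i) ?iota_uniq //=; last by rewrite mem_index_iota; lia.
rewrite eqxx addrC; congr (_ + _).
by apply: eq_bigr => j ji; rewrite (negPf ji).
Unshelve. all: by end_near. Qed.

(** Read from left to right, this turns boundary values back into integrals, hence into moments. *)
Lemma FTC_intervals (R : realType) (r : nat) (c : nat -> R) (f F : R -> R) :
  increasing_ends r c -> continuous f ->
  (forall x : R, is_derive x (1 : R) F (f x)) ->
  \sum_(1 <= j < (2 * r).+1) (-1) ^+ j * F (c j) =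
  \int[@lebesgue_measure R]_(x in intervals r c) f x.
Proof.
move=> hc cf dF; rewrite (@Rintegral_intervals _ _ _ (c 1%N - 1) _ F) //.
move=> j /andP[j1 jr]; rewrite ltrBlDr.
have [<-|j1'] := eqVneq 1%N j; first by rewrite ltrDl.
apply: ltr_wpDr => //; apply: (increasing_ends_lt hc) => //; lia.
Qed.

(** * Determinants of moments *)

(** The integral is iterated, so separated products are integrated one variable at a time. The
    coefficients [c] vary in the induction in order to absorb the factor of the first variable. *)
Lemma integral_pow_prod (R : realType) (E : set R) (N : nat) (I : Type)
    (s : seq I) (c : I -> R) (f : I -> 'I_N -> R -> R) :
  compact E -> (forall i j, continuous (f i j)) ->
  integral_pow E (fun x : 'rV_N => \sum_(i <- s) c i * \prod_j f i j (x 0 j)) =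
  \sum_(i <- s) c i * \prod_j \int[@lebesgue_measure R]_(y in E) f i j y.
Proof.
move=> cE; elim: N c f => [|N IH] c f cf /=.
  by apply: eq_bigr => i _; rewrite !big_ord0.
pose J i := \prod_(j < N) \int[@lebesgue_measure R]_(y in E) f i (lift ord0 j) y.
rewrite (_ : (fun y => _) = (fun y => \sum_(i <- s) (c i * J i) * f i ord0 y)).
  rewrite Rintegral_bigsum //; last first.
    by move=> i; apply: continuous_mulfun => // x; exact: cst_continuous.
  apply: eq_bigr => i _; rewrite RintegralZl; first last.
  - exact: integrable_continuous.
  - exact: compact_measurable.
  by rewrite big_ord_recl -mulrA [J i * _]mulrC.
apply/funext => y.
rewrite (_ : (fun x : 'rV_N => _) = (fun x : 'rV_N =>
    \sum_(i <- s) (c i * f i ord0 y) * \prod_(j < N) f i (lift ord0 j) (x 0 j))).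
  have /= -> // := IH (fun i => c i * f i ord0 y) (fun i j => f i (lift ord0 j)).
  by apply: eq_bigr => i _; rewrite mulrAC.
apply/funext => x; apply: eq_bigr => i _; rewrite big_ord_recl mulrA.
congr (_ * f i ord0 _ * _).
  have e : (ord0 : 'I_(1 + N)) = lshift N ord0 by exact: val_inj.
  have y0 : (y%:M : 'rV[R]_1) 0 ord0 = y by rewrite mxE eqxx mulr1n.
  by have := row_mxEl (y%:M : 'rV_1) x 0 ord0; rewrite -e y0.
apply: eq_bigr => j _; congr (f i _ _).
have e : (lift ord0 j : 'I_(1 + N)) = rshift 1 j by exact: val_inj.
by have := row_mxEr (y%:M : 'rV_1) x 0 j; rewrite -e.
Qed.

(** For each fixed [s] the inner sum is [(-1) ^+ s] times the determinant of the row-permuted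
    matrix, that is [\det M]. *)
Lemma sum_perm_perm_det (R : comNzRingType) (N : nat) (M : 'M[R]_N) :
  \sum_(s : 'S_N) \sum_(r : 'S_N) (-1) ^+ s * (-1) ^+ r * \prod_j M (s j) (r j) =
  N`!%:R * \det M.
Proof.
rewrite -card_Sn mulr_natl -[RHS]sumr_const; apply: eq_big => // s _.
have -> : \det M = (-1) ^+ s * \det (row_perm s M).
  by rewrite row_permE det_mulmx det_perm mulrA -expr2 sqrr_sign mul1r.
rewrite /determinant mulr_sumr; apply: eq_bigr => r _; rewrite mulrA.
by congr (_ * _); apply: eq_bigr => j _; rewrite mxE.
Qed.

(* Andreief's identity *)
Lemma integral_pow_det (R : realType) (E : set R) (N : nat) (w : R -> R)
    (F G : 'I_N -> R -> R) :
  compact E -> continuous w ->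
  (forall i, continuous (F i)) -> (forall i, continuous (G i)) ->
  integral_pow E (fun x : 'rV_N => (\prod_(i < N) w (x 0 i)) *
    \det (\matrix_(i < N, j < N) F i (x 0 j)) *
    \det (\matrix_(i < N, j < N) G i (x 0 j))) =
  N`!%:R * \det (\matrix_(i < N, j < N)
    \int[@lebesgue_measure R]_(x in E) (w x * F i x * G j x)).
Proof.
move=> cE cw cF cG; rewrite -sum_perm_perm_det pair_bigA /=.
rewrite (_ : (fun x => _) = (fun x : 'rV_N => \sum_(sr : 'S_N * 'S_N)
    (-1) ^+ sr.1 * (-1) ^+ sr.2 *
    \prod_j (w (x 0 j) * F (sr.1 j) (x 0 j) * G (sr.2 j) (x 0 j)))).
  rewrite (@integral_pow_prod _ _ _ _ _ (fun sr : 'S_N * 'S_N => (-1) ^+ sr.1 * (-1) ^+ sr.2)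
    (fun sr j x => w x * F (sr.1 j) x * G (sr.2 j) x)) //.
    by apply: eq_bigr => sr _; congr (_ * _); apply: eq_bigr => j _; rewrite mxE.
  by move=> sr j; apply: continuous_mulfun => //; exact: continuous_mulfun.
(* After transposition the permutations act on the functions and not on the variables, so the
   Leibniz expansions become products over the variables. *)
apply/funext => x; rewrite -[X in _ * X * _]det_tr -[X in _ * _ * X]det_tr.
rewrite /determinant -mulrA big_distrlr /= mulr_sumr -(pair_bigA _ (fun s r : 'S_N =>
  (-1) ^+ s * (-1) ^+ r * \prod_j (w (x 0 j) * F (s j) (x 0 j) * G (r j) (x 0 j)))) /=.
apply: eq_bigr => s _; rewrite mulr_sumr; apply: eq_bigr => r _.
rewrite !big_split /=.
have trE (H : 'I_N -> R -> R) (v : 'S_N) :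
    \prod_i (\matrix_(i < N, j < N) H i (x 0 j))^T i (v i) = \prod_i H (v i) (x 0 i).
  by apply: eq_bigr => i _; rewrite !mxE.
rewrite !trE.
move: (\prod_i w _) (\prod_i F _ _) (\prod_i G _ _) ((-1) ^+ s) ((-1) ^+ r) => a b c d g.
by ring.
Qed.

Lemma is_derive_prod (R : realType) (n : nat) (f : 'I_n -> R -> R) (df : 'I_n -> R)
    (x : R) :
  (forall i, is_derive x (1 : R) (f i) (df i)) ->
  is_derive x (1 : R) (fun y => \prod_i f i y)
    (\sum_i df i * \prod_(j | j != i) f j x).
Proof.
elim: n f df => [|n IH] f df fdf.
  rewrite big_ord0 (_ : (fun y => _) = cst 1); first exact: is_derive_cst.
  by apply/funext => y; rewrite big_ord0.
rewrite (_ : (fun y => _) = f ord0 * (fun y => \prod_i f (lift ord0 i) y)); last first.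
  by apply/funext => y; rewrite big_ord_recl.
have d0 := fdf ord0.
have d1 := IH _ _ (fun i => fdf (lift ord0 i)).
apply: is_derive_eq; rewrite /GRing.scale /= big_ord_recl addrC; congr (_ + _).
  rewrite mulrC; congr (_ * _); rewrite [RHS]big_mkcond big_ord_recl /= mul1r.
  by apply: eq_bigr.
rewrite mulr_sumr; apply: eq_bigr => i _; rewrite mulrCA; congr (_ * _).
rewrite [RHS]big_mkcond big_ord_recl /=; congr (_ * _).
by rewrite big_mkcond; apply: eq_bigr => j _; rewrite (inj_eq lift_inj).
Qed.

Lemma is_derive_det (R : realType) (N : nat) (A : R -> 'M[R]_N) (B : 'M[R]_N) (x : R) :
  (forall a b, is_derive x (1 : R) (fun y => A y a b) (B a b)) ->
  is_derive x (1 : R) (fun y => \det (A y)) (det_deriv (A x) B).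
Proof.
move=> dA.
rewrite (_ : det_deriv _ _ = \sum_(s : 'S_N) (-1) ^+ s *
    \sum_a B a (s a) * \prod_(i | i != a) A x i (s i)); last first.
  under [RHS]eq_bigr do rewrite mulr_sumr.
  rewrite exchange_big /=; apply: eq_bigr => a _.
  (* The terms of the differentiated Leibniz formula in which row [a] was differentiated add up to
     the determinant of [A x] with that row taken from [B]. *)
  pose C := \matrix_(i, j) if i == a then B i j else A x i j.
  have -> : \sum_b B a b * cofactor (A x) a b = \det C.
    rewrite (@det_row_subst _ _ (A x) _ a) => [|i j ia].
      by apply: eq_bigr => b _; rewrite mxE eqxx.
    by rewrite mxE (negPf ia).
  apply: eq_bigr => s _; congr (_ * _); rewrite (bigD1 a) //= mxE eqxx.
  by congr (_ * _); apply: eq_bigr => i ia; rewrite mxE (negPf ia).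
rewrite /determinant.
have H (s : 'S_N) : is_derive x (1 : R) ((-1) ^+ s \*: (fun y => \prod_i A y i (s i)))
    ((-1) ^+ s * \sum_a B a (s a) * \prod_(i | i != a) A x i (s i)).
  by apply: is_deriveZ; apply: is_derive_prod.
rewrite (_ : (fun y => _) = \sum_(s : 'S_N) ((-1) ^+ s \*: (fun y => \prod_i A y i (s i)))).
  elim/big_ind2 : _ => [|f df g dg fdf gdg|s _]; last exact: H.
    exact: is_derive_cst.
  exact: is_deriveD.
by apply/funext => y; rewrite fct_sumE.
Qed.

(** The list [L] of pairs (block, exponent) runs in the order of [blocks] and has no duplicates, so
    [index] inverts [nth] and yields [row]. A block must exist to give [nth] a default value. *)
Lemma blocks_labels (R : realType) (q : nat) (m : 'I_q -> nat) (N : nat) :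
  (0 < q)%N -> (\sum_(i < q) m i)%N = N ->
  exists lab : 'I_N -> 'I_q, exists e : 'I_N -> nat,
  exists row : forall i, 'I_(m i) -> 'I_N,
  [/\ forall (f : 'I_q -> R -> R) (a : 'I_N),
        nth (fun=> 0) (blocks m f) a = (fun x => x ^+ e a * f (lab a) x),
      forall i v, lab (row i v) = i,
      forall i v, e (row i v) = v
    & forall i a, lab a = i -> exists v, a = row i v].
Proof.
move=> q0 mN.
pose L := [seq (i, k) | i <- enum 'I_q, k <- iota 0 (m i)].
have sL : size L = N.
  rewrite size_allpairs_dep sumnE big_map -mN big_enum /=.
  by apply: eq_bigr => i _; rewrite size_iota.
have uL : uniq L.
  apply: allpairs_uniq_dep; [exact: enum_uniq|by move=> *; exact: iota_uniq|].
  by move=> [i k] [j l] _ _ /= [-> ->].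
have memL i k : ((i, k) \in L) = (k < m i)%N.
  apply/allpairsPdep/idP => [[j [l [_ + [-> ->]]]]|km].
    by rewrite mem_iota.
  by exists i, k; rewrite mem_enum mem_iota.
pose d := (Ordinal q0, 0%N).
pose lab (a : 'I_N) := (nth d L a).1; pose e (a : 'I_N) := (nth d L a).2.
have ltL i (v : 'I_(m i)) : (index (i, v : nat) L < N)%N.
  by rewrite -sL index_mem memL.
exists lab, e, (fun i v => Ordinal (ltL i v)); split.
- move=> f a; rewrite /blocks.
  have -> : [seq (fun x : R => x ^+ k * f i x) | i <- enum 'I_q, k <- iota 0 (m i)] =
      [seq (fun x : R => x ^+ p.2 * f p.1 x) | p <- L].
    rewrite map_flatten -map_comp; congr flatten; apply: eq_map => i /=.
    by rewrite -map_comp.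
  by rewrite (nth_map d) // sL.
- by move=> i v; rewrite /lab nth_index // memL.
- by move=> i v; rewrite /e nth_index // memL.
move=> i a ai.
have aL : nth d L a \in L by rewrite mem_nth // sL.
have aE : nth d L a = (i, e a) by rewrite -ai /lab /e; case: nth.
have ea : (e a < m i)%N by rewrite -memL -aE.
exists (Ordinal ea); apply: val_inj => /=.
by rewrite -aE index_uniq // sL.
Qed.

(** * Virasoro generators acting on one block *)

Section Side.
Variables (R : realType) (N : nat) (L : eqType) (lab : 'I_N -> L).
Variables (e : 'I_N -> nat) (i : L) (m : nat) (row : 'I_m -> 'I_N).
Hypothesis lab_row : forall v, lab (row v) = i.
Hypothesis exp_row : forall v, e (row v) = v.
Hypothesis row_onto : forall a, lab a = i -> exists v, a = row v.
Variables (eps : R) (G : (nat -> R) -> L -> nat -> 'I_N -> R).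
Hypothesis eps2 : eps * eps = 1.
Hypothesis derive_G : forall u n l v b, entire_times u -> (0 < n)%N ->
  is_derive (u n) (1 : R) (fun h => G [eta u with n |-> h] l v b)
    (if l == i then eps * G u l (v + n) b else 0).
Variables (u : nat -> R) (P : nat -> 'I_N -> R).
Hypothesis entire_u : entire_times u.
Hypothesis cvg_P : forall v b,
  \sum_(1 <= l < n) l%:R * (eps * u l) * G u i (v + l.-1) b @[n --> \oo] --> P v b.

Local Notation W u := (exp_det lab (G u)).
Local Notation Phi x := (fun u => exp_det lab (G u) x).
Local Notation cof := (cofactor (\matrix_(a, b) G u (lab a) (e a) b)).

(** In Jacobi's formula only the rows labelled [i] have nonzero derivative, and there [derive_G]
    raises the exponent; the cofactor sum along such a row is the determinant with that row
    raised. *)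
Lemma is_derive_exp_det (u' : nat -> R) x n : entire_times u' -> (0 < n)%N ->
  is_derive (u' n) (1 : R) (fun h => W [eta u' with n |-> h] x)
    (eps * \sum_(a | lab a == i) W u' (shift_exp a n x)).
Proof.
move=> eu n0; pose A h := \matrix_(a, b) G [eta u' with n |-> h] (lab a) (x a) b.
pose B := \matrix_(a, b) if lab a == i then eps * G u' (lab a) (x a + n) b else 0.
have uu : ([eta u' with n |-> u' n] : nat -> R) = u'.
  by apply/funext => k /=; case: eqP => [->|].
have dA a b : is_derive (u' n) (1 : R) (fun h => A h a b) (B a b).
  rewrite (_ : (fun h => _) = (fun h => G [eta u' with n |-> h] (lab a) (x a) b)).
    by rewrite mxE; apply: derive_G.
  by apply/funext => h; rewrite mxE.
have := is_derive_det dA; rewrite /A uu => dW; apply: is_derive_eq dW _.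
rewrite /det_deriv mulr_sumr [RHS]big_mkcond; apply: eq_bigr => a _.
have [ai|ai] := boolP (lab a == i).
  rewrite exp_det_set mulr_sumr; apply: eq_bigr => b _.
  by rewrite mxE ai [RHS]mulrA.
by rewrite big1 // => b _; rewrite mxE (negPf ai) mul0r.
Qed.

(** The sign built into [tder] cancels the one from [derive_G], since [eps * eps = 1]. *)
Lemma tder_exp_det (u' : nat -> R) x n : entire_times u' -> (0 < n)%N ->
  tder eps n (Phi x) u' = \sum_(a | lab a == i) W u' (shift_exp a n x).
Proof.
move=> eu n0; rewrite /tder ltz_nat n0 /partial derive1E /=.
have dW := is_derive_exp_det x eu n0.
by rewrite derive_val mulrA eps2 mul1r.
Qed.

Lemma tder2_exp_det (u' : nat -> R) x n n' : entire_times u' ->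
  (0 < n)%N -> (0 < n')%N ->
  tder eps n (tder eps n' (Phi x)) u' =
  \sum_(a | lab a == i) \sum_(b | lab b == i)
    W u' (shift_exp b n (shift_exp a n' x)).
Proof.
move=> eu n0 n0'; rewrite {1}/tder ltz_nat n0 /partial derive1E /=.
rewrite (_ : (fun h => _) = \sum_(a | lab a == i)
    (fun h => W [eta u' with n |-> h] (shift_exp a n' x))); last first.
  apply/funext => h; rewrite fct_sumE.
  by apply: tder_exp_det => //; exact: entire_times_update.
have dS : is_derive (u' n) (1 : R) (\sum_(a | lab a == i)
    (fun h => W [eta u' with n |-> h] (shift_exp a n' x)))
    (\sum_(a | lab a == i)
       eps * \sum_(b | lab b == i) W u' (shift_exp b n (shift_exp a n' x))).
  elim/big_ind2 : _ => [|f df g dg fdf gdg|a _]; last exact: is_derive_exp_det.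
    exact: is_derive_cst.
  exact: is_deriveD.
by rewrite derive_val -mulr_sumr mulrA eps2 mul1r.
Qed.

Lemma tder_le0 (k : int) f (u' : nat -> R) : k <= 0 -> tder eps k f u' = 0.
Proof. by rewrite /tder ltNge => ->. Qed.

Lemma tvar_le0 (k : int) (u' : nat -> R) : k <= 0 -> tvar eps k u' = 0.
Proof. by rewrite /tvar ltNge => ->. Qed.

(** The case [K = 0] fits the same formula: the constant term of [J1] is [m], the number of rows in
    the block, each raised by 0. *)
Lemma J1_exp_det (K : nat) :
  J1 eps K m (Phi e) u =
  \sum_(a | lab a == i) \sum_b G u (lab a) (e a + K) b * cof a b.
Proof.
rewrite /J1 tvar_le0 ?oppr_le0 // mulr0 mul0r addr0.
under [RHS]eq_bigr do rewrite -exp_det_set.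
case: K => [|K].
  rewrite tder_le0 // add0r eqxx mulr1.
  rewrite (sum_block lab_row exp_row row_onto).
  under eq_bigr do rewrite -/(shift_exp _ _ _) shift_exp0.
  by rewrite sumr_const card_ord mulr_natl.
by rewrite tder_exp_det // mulr0 mul0r addr0.
Qed.

(** Partial sums of the infinite first-order part of [J2] for [k = K - 1], with time derivatives
    already written as shifts; at [K = 0] the term [l = 1] is a shift by 0. *)
Let flux K n := \sum_(1 <= l < n) l%:R * (eps * u l) *
  \sum_(a | lab a == i) W u (shift_exp a (K + l).-1 e).

Let cvg_flux K : flux K n @[n --> \oo] -->
  \sum_(a | lab a == i) \sum_b P (e a + K) b * cof a b.
Proof.
rewrite (_ : flux K = (fun n => \sum_(a | lab a == i) \sum_b
   (\sum_(1 <= l < n) l%:R * (eps * u l) * G u i (e a + K + l.-1) b) * cof a b)).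
  apply: cvg_big => [|a _]; first exact: add_continuous.
  apply: cvg_big => [|b _]; first exact: add_continuous.
  by apply: cvgM; [exact: cvg_P|exact: cvg_cst].
apply/funext => n; rewrite /flux.
under [RHS]eq_bigr do under eq_bigr do rewrite mulr_suml.
under [RHS]eq_bigr do rewrite exchange_big /=.
rewrite [RHS]exchange_big /= !big_nat; apply: eq_bigr => l /andP[l0 _].
rewrite mulr_sumr; apply: eq_bigr => a /eqP ai.
rewrite exp_det_set mulr_sumr; apply: eq_bigr => b _.
rewrite ai [LHS]mulrA; congr (_ * _ * _); congr (G u i _ b); lia.
Qed.

(** Here [k = K - 1]. The second-order part and the terms carrying [m] combine into the coefficients
    [e a] and [K]; the infinite sum gives [P]. The quadratic term in the times vanishes because
    [k >= -1]. *)
Lemma J2_exp_det (K : nat) :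
  J2 eps (K%:Z - 1) m (Phi e) u =
  \sum_(a | lab a == i) \sum_b
    ((e a)%:R * G u (lab a) (e a + K).-1 b + K%:R * G u (lab a) (e a + K.-1) b
     + P (e a + K) b) * cof a b.
Proof.
under [RHS]eq_bigr do under eq_bigr do rewrite !mulrDl -!mulrA.
under [RHS]eq_bigr do rewrite !big_split /= -!mulr_sumr -!exp_det_set.
rewrite !big_split /=.
have limK : limn (flux K) = \sum_(a | lab a == i) \sum_b P (e a + K) b * cof a b.
  by apply/cvg_lim => //; exact: cvg_flux.
rewrite -limK.
pose flow (k : int) n := \sum_(1 <= l < n) l%:R * tvar eps l u *
  tder eps (l%:Z + k) (Phi e) u.
have shift0 a : set_exp a (e a) e = e by apply/funext => c; rewrite /set_exp /=; case: eqP => // ->.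
have flowS K' : flow (K'.+1%:Z - 1) = flux K'.+1.
  apply/funext => n; rewrite /flow /flux !big_nat.
  apply: eq_bigr => l /andP[l0 _]; congr (_ * _).
    by rewrite /tvar ltz_nat l0.
  rewrite (_ : l%:Z + _ = (K' + l)%N); last lia.
  by rewrite tder_exp_det //; lia.
(* For k = -1 the l = 1 term is missing from J2, where d/dt_0 is 0; it is
   supplied by the term k t_1 of the first-order part. *)
have cvg_flow0 : flow (0%:Z - 1) @ \oo -->
    limn (flux 0) - eps * u 1%N * (m%:R * W u e).
  rewrite (_ : flow _ = (fun n => flux 0 n -
      \sum_(1 <= l < n) if l == 1%N then eps * u 1%N * (m%:R * W u e) else 0)).
    apply: cvgB; first exact: (cvgP _ (@cvg_flux 0)).
    apply: cvg_near_cst; exists 2%N => // n /= n2.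
    rewrite big_ltn //= big_nat big1 ?addr0 // => l /andP[l2 _].
    by rewrite gtn_eqF.
  apply/funext => n; rewrite /flow /flux -sumrB !big_nat.
  apply: eq_bigr => l /andP[l0 _]; rewrite {1}/tvar ltz_nat l0.
  have [->|l1] := eqVneq l 1%N.
    rewrite tder_le0 // mulr0 mul1r add0n.
    under eq_bigr do rewrite shift_exp0.
    rewrite (sum_block lab_row exp_row row_onto (fun=> W u e)).
    by rewrite sumr_const card_ord -[in RHS](mulr_natl (W u e)) subrr.
  rewrite subr0; congr (_ * _).
  rewrite (_ : l%:Z + _ = l.-1); last lia.
  by rewrite tder_exp_det //; lia.
rewrite /J2 -/(flow (K%:Z - 1)).
case: K {limK} => [|[|K]].
- rewrite (cvg_lim _ cvg_flow0) //.
  have -> : `|0%:Z - 1|%N = 1%N by [].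
  rewrite !big_geq // mul0r addr0 add0r mul0r addr0.
  rewrite [X in _ = _ + X + _]big1 => [|a _]; last by rewrite mul0r.
  rewrite [X in _ = X + _ + _]big1 => [|a /eqP ai].
    rewrite tder_le0 // !add0r !opprK /tvar ltr01 /= mulrA mulVf ?pnatr_eq0 //.
    by rewrite mulr0 mul0r addr0 mulr1z -pmulrn; ring.
  (* For [k = -1], lowering row [a] by one produces the row of exponent [e a - 1] of the same block,
     so the determinant vanishes; when [e a = 0] the coefficient does. *)
  rewrite addn0; case ea : (e a) => [|v]; first by rewrite mul0r.
  have [w aw] := row_onto ai.
  have vm : (v < m)%N.
    by rewrite (leq_trans _ (ltn_ord w)) // -exp_row -aw ea.
  rewrite (@exp_det_eq0 _ _ _ _ _ a (row (Ordinal vm))) ?mulr0 //.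
  + by rewrite lab_row.
  + by apply/eqP => /(congr1 e); rewrite exp_row ea /=; lia.
  + rewrite /set_exp /= eqxx exp_row /=; case: eqP => // /(congr1 e).
(* For [k = 0] no second derivative occurs, and the constant of [J2] is
   [m (m + 1) / 2 = m (m - 1) / 2 + m]: the sum of the exponents plus one for each row. *)
- rewrite flowS subrr /= !big_geq //.
  under [X in _ = X + _ + _]eq_bigr do rewrite addn1 /= shift0.
  under [X in _ = _ + X + _]eq_bigr do rewrite addn0 shift0 mul1r.
  rewrite (sum_block lab_row exp_row row_onto (fun=> W u e)) sumr_const card_ord.
  have := sum_block_exp (lab := lab) (G u) lab_row exp_row row_onto.
  rewrite tder_le0 // oppr0 mulr0z -[W u e *+ m]mulr_natl intrM intrD -!pmulrn.
  move: (W u e) (limn _) (\sum_(a | _) _) => w l S HS.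
  by lra.
(* For [k >= 1] the block size cancels: half of [k + 1 - 2 m] plus [m + (k + 1) / 2] is [k + 1]. *)
- have -> : `|K.+2%:Z - 1|%N = K.+1 by lia.
  have k0 : - (K.+2%:Z - 1) <= 0 by lia.
  rewrite flowS tvar_le0 // mulr0 mul0r addr0.
  have -> : \sum_(1 <= l < K.+1) (l%:R * tvar eps l u) *
      ((- (K.+2%:Z - 1) - l%:Z)%:~R * tvar eps (- (K.+2%:Z - 1) - l%:Z) u) = 0.
    by apply: big1 => l _; rewrite (@tvar_le0 (_ - l%:Z)) ?mulr0 //; lia.
  have -> : \sum_(1 <= l < K.+1) tder eps l (tder eps (K.+2%:Z - 1 - l%:Z) (Phi e)) u =
      \sum_(1 <= l < K.+1) \sum_(a | lab a == i) \sum_(b | lab b == i)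
        W u (shift_exp a l (shift_exp b (K.+1 - l) e)).
    rewrite !big_nat; apply: eq_bigr => l /andP[l0 lK].
    rewrite (_ : K.+2%:Z - 1 - l%:Z = (K.+1 - l)%N); last lia.
    by rewrite tder2_exp_det ?subn_gt0 // exchange_big.
  rewrite (sum_block_double_shift (G u) lab_row exp_row row_onto) //.
  rewrite (_ : K.+2%:Z - 1 = K.+1); last lia.
  have -> : (K.+1%:Z == 0)%:R = 0 :> R by [].
  rewrite tder_exp_det // mulr0 !mul0r !addr0.
  under [X in _ = X + _ + _]eq_bigr do rewrite addnS /= -/(shift_exp _ _ _).
  under [X in _ = _ + X + _]eq_bigr do rewrite /= -/(shift_exp _ _ _).
  rewrite -[X in _ = _ + X + _]mulr_sumr.
  rewrite (_ : K.+1%:Z + 1 = K.+2); last lia.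
  rewrite -!pmulrn.
  move: (limn _) (\sum_(a | _) W u _) (\sum_(a | _) _) => l S T.
  by rewrite -[K.+2%:R]natr1; lra.
Qed.

End Side.

(** * Moments *)

Definition weight (R : realType) (a alpha b beta : R) (s t : nat -> R) (x : R) : R :=
  psi a alpha s x * phi b beta t x * expR (- (x ^+ 2 / 2)).

Definition moment (R : realType) (E : set R) (a alpha b beta : R)
    (s t : nat -> R) (l : nat) : R :=
  \int[@lebesgue_measure R]_(x in E) (x ^+ l * weight a alpha b beta s t x).

Lemma weight_updatel (R : realType) (a alpha b beta : R) (s t : nat -> R) (n : nat)
    (h x : R) : (0 < n)%N -> entire_times s ->
  weight a alpha b beta [eta s with n |-> h] t x =
  expR (-1 * (h - s n) * x ^+ n) * weight a alpha b beta s t x.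
Proof.
move=> n0 es; rewrite /weight /psi potential_update // !mulrA -expRD.
by congr (expR _ * _ * _); ring.
Qed.

Lemma weight_updater (R : realType) (a alpha b beta : R) (s t : nat -> R) (n : nat)
    (h x : R) : (0 < n)%N -> entire_times t ->
  weight a alpha b beta s [eta t with n |-> h] x =
  expR (1 * (h - t n) * x ^+ n) * weight a alpha b beta s t x.
Proof.
move=> n0 et; rewrite /weight /phi potential_update //.
rewrite (_ : _ + _ + (_ + _) = 1 * (h - t n) * x ^+ n +
  (b * x + beta * x ^+ 2 + potential t x)); last by ring.
by rewrite expRD; ring.
Qed.

Section Weight.
Variables (R : realType) (a alpha b beta : R) (s t : nat -> R).
Hypotheses (es : entire_times s) (et : entire_times t).
Local Notation ker := (weight a alpha b beta s t).
Local Notation mom := (fun E => moment E a alpha b beta s t).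

(** Logarithmic derivative of the integrand; the [- 1] next to [2 * alpha + 2 * beta] is the
    Gaussian's. *)
Lemma is_derive_weight (x : R) : is_derive x (1 : R) ker
  ((a + b + (2 * alpha + 2 * beta - 1) * x - potential_deriv s x + potential_deriv t x)
   * ker x).
Proof.
pose L : R -> R := (a + b) \*: id + (alpha + beta - 2^-1) \*: (id ^+ 2)
  - potential s + potential t.
have kerE : ker = expR \o L.
  apply/funext => y; rewrite /weight /psi /phi /= -!expRD; congr expR.
  rewrite /L (_ : (_ + _) y = (a + b) * y + (alpha + beta - 2^-1) * y ^+ 2
    - potential s y + potential t y); first by ring.
  by rewrite !fctE.
have ds := is_derive_potential x es; have dt := is_derive_potential x et.
have dL : is_derive x (1 : R) L
    (a + b + (2 * alpha + 2 * beta - 1) * x - potential_deriv s x + potential_deriv t x).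
  apply: is_derive_eq; rewrite /GRing.scale /= expr1 !mulr1; congr (_ - _ + _).
  by rewrite mulrA; congr (_ + _ * _); lra.
have := is_derive1_comp (is_derive_expR (L x)) dL.
by rewrite mulrC kerE.
Qed.

Lemma continuous_weight : continuous ker.
Proof. exact: (is_derive_continuous is_derive_weight). Qed.

Lemma continuous_monomial_weight l : continuous (fun x : R => x ^+ l * ker x).
Proof.
apply: continuous_mulfun; [exact: exprn_continuous|exact: continuous_weight].
Qed.

(** The right side integrates the derivative of [x ^+ l * ker x]. At [l = 0] the truncated [l.-1] is
    harmless, its coefficient being 0. *)
Lemma boundary_moment (r : nat) (c : nat -> R) (l : nat) : increasing_ends r c ->
  \sum_(1 <= i < (2 * r).+1) (-1) ^+ i * (c i ^+ l * ker (c i)) =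
  l%:R * mom (intervals r c) l.-1 + (a + b) * mom (intervals r c) l
  + (2 * alpha + 2 * beta - 1) * mom (intervals r c) l.+1
  - \int[@lebesgue_measure R]_(x in intervals r c)
      (potential_deriv s x * (x ^+ l * ker x))
  + \int[@lebesgue_measure R]_(x in intervals r c)
      (potential_deriv t x * (x ^+ l * ker x)).
Proof.
move=> hc; have cE := @compact_intervals R r c.
have cm l' k : continuous (fun x : R => k * (x ^+ l' * ker x)).
  apply: continuous_mulfun; last exact: continuous_monomial_weight.
  by move=> x; exact: cst_continuous.
have cp u : entire_times u -> continuous (fun x : R => potential_deriv u x * (x ^+ l * ker x)).
  move=> eu; apply: continuous_mulfun; last exact: continuous_monomial_weight.
  exact: continuous_potential_deriv.
pose D (x : R) := l%:R * (x ^+ l.-1 * ker x) + (a + b) * (x ^+ l * ker x)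
  + (2 * alpha + 2 * beta - 1) * (x ^+ l.+1 * ker x)
  - potential_deriv s x * (x ^+ l * ker x) + potential_deriv t x * (x ^+ l * ker x).
have c1 : continuous (fun x : R => l%:R * (x ^+ l.-1 * ker x) + (a + b) * (x ^+ l * ker x)).
  by apply: continuous_addfun; exact: cm.
have c2 : continuous (fun x : R => l%:R * (x ^+ l.-1 * ker x) + (a + b) * (x ^+ l * ker x)
    + (2 * alpha + 2 * beta - 1) * (x ^+ l.+1 * ker x)).
  by apply: continuous_addfun => //; exact: cm.
have c3 : continuous (fun x : R => l%:R * (x ^+ l.-1 * ker x) + (a + b) * (x ^+ l * ker x)
    + (2 * alpha + 2 * beta - 1) * (x ^+ l.+1 * ker x)
    - potential_deriv s x * (x ^+ l * ker x)).
  by apply: continuous_subfun => //; exact: cp.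
have cD : continuous D by apply: continuous_addfun => //; exact: cp.
have dF (x : R) : is_derive x (1 : R) (fun x : R => x ^+ l * ker x) (D x).
  have dk := is_derive_weight x.
  rewrite (_ : (fun x : R => _) = (id : R -> R) ^+ l * ker); last first.
    by apply/funext => y; rewrite !fctE.
  apply: is_derive_eq; rewrite /GRing.scale /= /D mulr1 !fctE.
  by rewrite exprSr; ring.
have /= -> := FTC_intervals hc cD dF.
have mE : measurable (intervals r c) by exact: compact_measurable.
have I f := @integrable_continuous R (intervals r c) cE f.
rewrite /D RintegralD //; [|exact: I c3|exact: I (cp _ et)].
rewrite RintegralB //; [|exact: I c2|exact: I (cp _ es)].
rewrite RintegralD //; [|exact: I c1|exact: I (cm _ _)].
rewrite RintegralD //; [|exact: I (cm _ _)|exact: I (cm _ _)].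
by rewrite !RintegralZl //; apply: I; exact: continuous_monomial_weight.
Qed.

Lemma is_derive_momentl (E : set R) (n l : nat) : compact E -> (0 < n)%N ->
  is_derive (s n) (1 : R) (fun h => moment E a alpha b beta [eta s with n |-> h] t l)
    (-1 * mom E (l + n)%N).
Proof.
move=> cE n0.
have := is_derive_Rintegral_expR (-1) (s n) n cE (@continuous_monomial_weight l).
rewrite (_ : (fun x : R => x ^+ n * _) = (fun x : R => x ^+ (l + n) * ker x)); last first.
  by apply/funext => x; rewrite mulrA -exprD addnC.
congr is_derive; apply/funext => h; apply: eq_Rintegral => x _.
by rewrite weight_updatel // mulrCA.
Qed.

Lemma is_derive_momentr (E : set R) (n l : nat) : compact E -> (0 < n)%N ->
  is_derive (t n) (1 : R) (fun h => moment E a alpha b beta s [eta t with n |-> h] l)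
    (1 * mom E (l + n)%N).
Proof.
move=> cE n0.
have := is_derive_Rintegral_expR 1 (t n) n cE (@continuous_monomial_weight l).
rewrite (_ : (fun x : R => x ^+ n * _) = (fun x : R => x ^+ (l + n) * ker x)); last first.
  by apply/funext => x; rewrite mulrA -exprD addnC.
congr is_derive; apply/funext => h; apply: eq_Rintegral => x _.
by rewrite weight_updater // mulrCA.
Qed.

Lemma cvg_flow_moment (E : set R) (u : nat -> R) (eps : R) (l : nat) :
  compact E -> entire_times u ->
  \sum_(1 <= j < n) j%:R * (eps * u j) * mom E (l + j.-1)%N @[n --> \oo] -->
  eps * \int[@lebesgue_measure R]_(x in E) (potential_deriv u x * (x ^+ l * ker x)).
Proof.
move=> cE eu.
rewrite (_ : (fun n => _) = (fun n => eps * \sum_(1 <= j < n) j%:R * u j *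
    \int[@lebesgue_measure R]_(x in E) (x ^+ j.-1 * (x ^+ l * ker x)))).
  apply: cvgM; first exact: cvg_cst.
  exact: (cvg_Rintegral_potential_deriv cE eu (@continuous_monomial_weight l)).
apply/funext => n; rewrite /= mulr_sumr; apply: eq_bigr => j _.
rewrite mulrCA !mulrA; congr (_ * _); apply: eq_Rintegral => x _.
by rewrite mulrA -exprD addnC.
Qed.

End Weight.

(** * The two halves of the Virasoro operator *)

(* The determinant formula for tau holds only at entire times, so functions of
   the times are compared there only. *)
Lemma tder_congr (R : realType) (eps : R) (k : int) (f g : (nat -> R) -> R) u :
  (forall v, entire_times v -> f v = g v) -> entire_times u ->
  tder eps k f u = tder eps k g u.
Proof.
move=> fg eu; rewrite /tder /partial; case: ifP => // _; congr (_ * _).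
congr (derive1 _ _); apply/funext => h; apply: fg; exact: entire_times_update.
Qed.

Lemma J1_congr (R : realType) (eps : R) (k n : int) (f g : (nat -> R) -> R) u :
  (forall v, entire_times v -> f v = g v) -> entire_times u ->
  J1 eps k n f u = J1 eps k n g u.
Proof. by move=> fg eu; rewrite /J1 (tder_congr eps k fg eu) fg. Qed.

Lemma J2_congr (R : realType) (eps : R) (k n : int) (f g : (nat -> R) -> R) u :
  (forall v, entire_times v -> f v = g v) -> entire_times u ->
  J2 eps k n f u = J2 eps k n g u.
Proof.
move=> fg eu.
have fgk l v : entire_times v -> tder eps l f v = tder eps l g v.
  by move=> ev; exact: tder_congr.
pose S1 h := \sum_(1 <= i < `|k|%N) tder eps i (tder eps (k - i%:Z) h) u.
pose S2 h N := \sum_(1 <= i < N) i%:R * tvar eps i u * tder eps (i%:Z + k) h u.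
have S1E : S1 f = S1 g.
  by apply: eq_bigr => i _; apply: tder_congr eu => v; exact: fgk.
have S2E : S2 f = S2 g.
  by apply/funext => N; apply: eq_bigr => i _; rewrite fgk.
have J2E h : J2 eps k n h u = 2^-1 * (S1 h + 2 * limn (S2 h) +
   (\sum_(1 <= i < `|k|%N)
      (i%:R * tvar eps i u) * ((- k - i%:Z)%:~R * tvar eps (- k - i%:Z) u)) * h u)
   + (n%:~R + (k + 1)%:~R / 2) * (tder eps k h u + (- k)%:~R * tvar eps (- k) u * h u)
   + (n * (n + 1))%:~R / 2 * (k == 0)%:R * h u by [].
by rewrite (J2E f) (J2E g) S1E S2E (fgk k u eu) (fg u eu).
Qed.

Lemma continuous_potential (R : realType) (u : nat -> R) :
  entire_times u -> continuous (potential u).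
Proof.
move=> eu; apply: (@is_derive_continuous _ _ (potential_deriv u)) => x.
exact: is_derive_potential.
Qed.

Lemma continuous_psi (R : realType) (a alpha : R) (s : nat -> R) :
  entire_times s -> continuous (psi a alpha s).
Proof.
move=> es x; apply: continuous_comp; last exact: continuous_expR.
apply: continuous_subfun; last exact: continuous_potential.
apply: continuous_addfun; last exact: continuous_monomial.
by apply: continuous_mulfun => y; [exact: cst_continuous|exact: cvg_id].
Qed.

Lemma continuous_phi (R : realType) (b beta : R) (t : nat -> R) :
  entire_times t -> continuous (phi b beta t).
Proof.
move=> et x; apply: continuous_comp; last exact: continuous_expR.
apply: continuous_addfun; last exact: continuous_potential.
apply: continuous_addfun; last exact: continuous_monomial.
by apply: continuous_mulfun => y; [exact: cst_continuous|exact: cvg_id].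
Qed.

Lemma continuous_gaussian (R : realType) :
  continuous (fun x : R => expR (- (x ^+ 2 / 2))).
Proof.
move=> x; apply: continuous_comp; last exact: continuous_expR.
have -> : (fun x : R => - (x ^+ 2 / 2)) = (fun x => - 2^-1 * x ^+ 2).
  by apply/funext => y; rewrite mulNr mulrC.
exact: continuous_monomial.
Qed.

Lemma update_id (I : eqType) (T : Type) (f : I -> T) (i : I) :
  ([eta f with i |-> f i] : I -> T) = f.
Proof. by apply/funext => k /=; case: eqP => [->|]. Qed.

Lemma entire_update (R : realType) (I : eqType) (f : I -> nat -> R) (i : I) (u : nat -> R) :
  (forall j, entire_times (f j)) -> entire_times u ->
  forall j, entire_times (([eta f with i |-> u] : I -> nat -> R) j).
Proof. by move=> ef eu j /=; case: eqP. Qed.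

Section Tau.
Variables (R : realType) (p q N : nat) (m : 'I_q -> nat) (n : 'I_p -> nat).
Variables (a alpha : 'I_q -> R) (b beta : 'I_p -> R).
Variables (lab : 'I_N -> 'I_q) (e : 'I_N -> nat).
Variables (lab' : 'I_N -> 'I_p) (e' : 'I_N -> nat).
Hypothesis blocks_m : forall (f : 'I_q -> R -> R) (x : 'I_N),
  nth (fun=> 0) (blocks m f) x = (fun z => z ^+ e x * f (lab x) z).
Hypothesis blocks_n : forall (f : 'I_p -> R -> R) (x : 'I_N),
  nth (fun=> 0) (blocks n f) x = (fun z => z ^+ e' x * f (lab' x) z).

Definition block_moment (E : set R) (s : 'I_q -> nat -> R) (t : 'I_p -> nat -> R)
    (i : 'I_q) (j : 'I_p) (l : nat) : R :=
  moment E (a i) (alpha i) (b j) (beta j) (s i) (t j) l.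

(** Andreief's identity; its factor [N!] cancels the normalisation of [tau]. *)
Lemma tau_det (E : set R) (s : 'I_q -> nat -> R) (t : 'I_p -> nat -> R) :
  compact E -> (forall i, entire_times (s i)) -> (forall j, entire_times (t j)) ->
  tau N m n a alpha b beta E s t =
  \det (\matrix_(x < N, y < N) block_moment E s t (lab x) (lab' y) (e x + e' y)).
Proof.
move=> cE es et; rewrite /tau /det_at.
pose w (z : R) := expR (- (z ^+ 2 / 2)).
pose F (x : 'I_N) := nth (fun=> 0) (blocks m (fun i => psi (a i) (alpha i) (s i))) x.
pose G (y : 'I_N) := nth (fun=> 0) (blocks n (fun j => phi (b j) (beta j) (t j))) y.
have cF x : continuous (F x).
  rewrite /F blocks_m; apply: continuous_mulfun; first exact: exprn_continuous.
  exact: continuous_psi.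
have cG x : continuous (G x).
  rewrite /G blocks_n; apply: continuous_mulfun; first exact: exprn_continuous.
  exact: continuous_phi.
have := integral_pow_det cE (@continuous_gaussian R) cF cG.
rewrite /F /G => ->; rewrite mulKf ?pnatr_eq0 -?lt0n ?fact_gt0 //.
congr (\det _); apply/matrixP => x y; rewrite !mxE; apply: eq_Rintegral => z _.
rewrite blocks_m blocks_n /= /weight exprD. ring.
Qed.

Variables (E : set R) (s : 'I_q -> nat -> R) (t : 'I_p -> nat -> R).
Hypothesis compact_E : compact E.
Hypotheses (es : forall i, entire_times (s i)) (et : forall j, entire_times (t j)).
Local Notation mom := (block_moment E s t).
Local Notation M := (\matrix_(x < N, y < N) mom (lab x) (lab' y) (e x + e' y)).

(** The sum of [k * u k * mom i j (l + k - 1)] over [k >= 1], in closed form. The times [u] are a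
    separate argument so as to serve for both [s i] and [t j]. *)
Definition moment_diff (u : nat -> R) (i : 'I_q) (j : 'I_p) (l : nat) : R :=
  \int[@lebesgue_measure R]_(x in E) (potential_deriv u x *
    (x ^+ l * weight (a i) (alpha i) (b j) (beta j) (s i) (t j) x)).

(** [J1_exp_det] and [J2_exp_det] with [eps = -1], the matrix rows carrying the exponents of the
    [psi] blocks. *)
Lemma virasoro_psi (i : 'I_q) (row : 'I_(m i) -> 'I_N) (K : nat) :
  (forall v, lab (row v) = i) -> (forall v, e (row v) = v) ->
  (forall x, lab x = i -> exists v, x = row v) ->
  let Fi u := tau N m n a alpha b beta E [eta s with i |-> u] t in
  J2 (-1) (K%:Z - 1) (m i) Fi (s i) + a i * J1 (-1) K (m i) Fi (s i)
  - (1 - 2 * alpha i) * J1 (-1) K.+1 (m i) Fi (s i) =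
  \sum_(x | lab x == i) \sum_y
    ((e x)%:R * mom (lab x) (lab' y) ((e x + K).-1 + e' y)
     + K%:R * mom (lab x) (lab' y) (e x + K.-1 + e' y)
     - moment_diff (s i) (lab x) (lab' y) (e x + K + e' y)
     + a i * mom (lab x) (lab' y) (e x + K + e' y)
     - (1 - 2 * alpha i) * mom (lab x) (lab' y) (e x + K.+1 + e' y)) * cofactor M x y.
Proof.
move=> lab_row exp_row row_onto Fi; have esi : entire_times (s i) by exact: es.
pose G (u : nat -> R) l v (y : 'I_N) :=
  block_moment E [eta s with i |-> u] t l (lab' y) (v + e' y).
have FiE u : entire_times u -> Fi u = exp_det lab (G u) e.
  by move=> eu; rewrite /Fi (tau_det compact_E (entire_update es eu) et).
rewrite (J2_congr _ _ _ FiE esi) !(J1_congr _ _ _ FiE esi).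
have eps2 : -1 * -1 = 1 :> R by rewrite mulrNN mulr1.
have derive_G u k l v y : entire_times u -> (0 < k)%N ->
    is_derive (u k) (1 : R) (fun h => G [eta u with k |-> h] l v y)
      (if l == i then -1 * G u l (v + k) y else 0).
  move=> eu k0; rewrite /G /block_moment /=; case: eqP => [->|_].
    rewrite addnAC; exact: is_derive_momentl.
  exact: is_derive_cst.
have cvg_P v y : \sum_(1 <= l < k) l%:R * (-1 * s i l) * G (s i) i (v + l.-1) y
    @[k --> \oo] --> -1 * moment_diff (s i) i (lab' y) (v + e' y).
  rewrite /G update_id /block_moment; under eq_fun do under eq_bigr do rewrite addnAC.
  exact: cvg_flow_moment.
rewrite (J2_exp_det lab_row exp_row row_onto eps2 derive_G esi cvg_P).
rewrite !(J1_exp_det lab_row exp_row row_onto eps2 derive_G esi).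
rewrite /G update_id !mulr_sumr -big_split -sumrB /=; apply: eq_bigr => x /eqP xi.
rewrite !mulr_sumr -big_split -sumrB /=; apply: eq_bigr => y _.
by rewrite xi; ring.
Qed.

(** The same on the transposed matrix with [eps = 1]. The extra term in [- (k + 1)] cancels the
    summand with coefficient [K] of [J2_exp_det], so that summand survives on the [psi] side
    alone. *)
Lemma virasoro_phi (j : 'I_p) (row : 'I_(n j) -> 'I_N) (K : nat) :
  (forall v, lab' (row v) = j) -> (forall v, e' (row v) = v) ->
  (forall x, lab' x = j -> exists v, x = row v) ->
  let Fj u := tau N m n a alpha b beta E s [eta t with j |-> u] in
  J2 1 (K%:Z - 1) (n j) Fj (t j) + b j * J1 1 K (n j) Fj (t j)
  + 2 * beta j * J1 1 K.+1 (n j) Fj (t j) - K%:R * J1 1 (K%:Z - 1) (n j) Fj (t j) =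
  \sum_(y | lab' y == j) \sum_x
    ((e' y)%:R * mom (lab x) (lab' y) (e x + (e' y + K).-1)
     + moment_diff (t j) (lab x) (lab' y) (e x + (e' y + K))
     + b j * mom (lab x) (lab' y) (e x + (e' y + K))
     + 2 * beta j * mom (lab x) (lab' y) (e x + (e' y + K.+1))) * cofactor M x y.
Proof.
move=> lab_row exp_row row_onto Fj; have etj : entire_times (t j) by exact: et.
pose G (u : nat -> R) l v (x : 'I_N) :=
  block_moment E s [eta t with j |-> u] (lab x) l (e x + v).
have GT u : \matrix_(y, x) G u (lab' y) (e' y) x = (\matrix_(x < N, y < N)
    block_moment E s [eta t with j |-> u] (lab x) (lab' y) (e x + e' y))^T.
  by apply/matrixP => y x; rewrite mxE [RHS]mxE [RHS]mxE.
have FjE u : entire_times u -> Fj u = exp_det lab' (G u) e'.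
  move=> eu; rewrite /Fj (tau_det compact_E es (entire_update et eu)).
  by rewrite /exp_det [in RHS]GT det_tr.
rewrite (J2_congr _ _ _ FjE etj) !(J1_congr _ _ _ FjE etj).
have eps2 : 1 * 1 = 1 :> R by rewrite mulr1.
have derive_G u k l v x : entire_times u -> (0 < k)%N ->
    is_derive (u k) (1 : R) (fun h => G [eta u with k |-> h] l v x)
      (if l == j then 1 * G u l (v + k) x else 0).
  move=> eu k0; rewrite /G /block_moment /=; case: eqP => [->|_].
    rewrite addnA; exact: is_derive_momentr.
  exact: is_derive_cst.
have cvg_P v x : \sum_(1 <= l < k) l%:R * (1 * t j l) * G (t j) j (v + l.-1) x
    @[k --> \oo] --> 1 * moment_diff (t j) (lab x) j (e x + v).
  rewrite /G update_id /block_moment; under eq_fun do under eq_bigr do rewrite addnA.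
  exact: cvg_flow_moment.
have cofT x y : cofactor (\matrix_(y, x) G (t j) (lab' y) (e' y) x) y x =
    cofactor M x y.
  by rewrite [in LHS]GT update_id cofactor_tr.
(* At [K = 0] the index of [J1] is -1, outside the range of [J1_exp_det], but the coefficient is
   0. *)
have KJ1 : K%:R * J1 1 (K%:Z - 1) (n j) (fun u => exp_det lab' (G u) e') (t j) =
    K%:R * \sum_(y | lab' y == j) \sum_x G (t j) (lab' y) (e' y + K.-1) x *
      cofactor (\matrix_(y, x) G (t j) (lab' y) (e' y) x) y x.
  case: K => [|K]; first by rewrite !mul0r.
  rewrite (_ : K.+1%:Z - 1 = K); last lia.
  by rewrite (J1_exp_det lab_row exp_row row_onto eps2 derive_G etj).
rewrite KJ1 (J2_exp_det lab_row exp_row row_onto eps2 derive_G etj cvg_P).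
rewrite !(J1_exp_det lab_row exp_row row_onto eps2 derive_G etj).
rewrite !mulr_sumr -!big_split -sumrB /=; apply: eq_bigr => y /eqP yj.
rewrite !mulr_sumr -!big_split -sumrB /=; apply: eq_bigr => x _.
rewrite [in LHS]cofT /G update_id yj.
move: (cofactor _ _ _) => d.
by ring.
Qed.

End Tau.

(** * The boundary operator *)

(** Differentiation in [c i] replaces a moment by the signed value of its integrand at [c i]; the
    factor [c i ^ (k + 1)] adds [K] to the exponent, and [boundary_moment] returns to moments. *)
Lemma boundary_tau (R : realType) (p q N r : nat) (m : 'I_q -> nat) (n : 'I_p -> nat)
    (a alpha : 'I_q -> R) (b beta : 'I_p -> R) (lab : 'I_N -> 'I_q) (e : 'I_N -> nat)
    (lab' : 'I_N -> 'I_p) (e' : 'I_N -> nat) (c : nat -> R)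
    (s : 'I_q -> nat -> R) (t : 'I_p -> nat -> R) (K : nat) :
  (forall (f : 'I_q -> R -> R) (x : 'I_N),
    nth (fun=> 0) (blocks m f) x = (fun z => z ^+ e x * f (lab x) z)) ->
  (forall (f : 'I_p -> R -> R) (x : 'I_N),
    nth (fun=> 0) (blocks n f) x = (fun z => z ^+ e' x * f (lab' x) z)) ->
  increasing_ends r c ->
  (forall i, entire_times (s i)) -> (forall j, entire_times (t j)) ->
  let mom := block_moment a alpha b beta (intervals r c) s t in
  boundary_op r (K%:Z - 1)
    (fun c' => tau N m n a alpha b beta (intervals r c') s t) c =
  \sum_x \sum_y
    (let l := (e x + e' y + K)%N in
     l%:R * mom (lab x) (lab' y) l.-1
     + (a (lab x) + b (lab' y)) * mom (lab x) (lab' y) l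
     + (2 * alpha (lab x) + 2 * beta (lab' y) - 1) * mom (lab x) (lab' y) l.+1
     - moment_diff a alpha b beta (intervals r c) s t (s (lab x)) (lab x) (lab' y) l
     + moment_diff a alpha b beta (intervals r c) s t (t (lab' y)) (lab x) (lab' y) l) *
    cofactor (\matrix_(x < N, y < N) mom (lab x) (lab' y) (e x + e' y)) x y.
Proof.
move=> blocks_m blocks_n hc es et mom.
pose M c' := \matrix_(x < N, y < N)
  block_moment a alpha b beta (intervals r c') s t (lab x) (lab' y) (e x + e' y).
pose g x y (z : R) := z ^+ (e x + e' y) * weight (a (lab x)) (alpha (lab x))
  (b (lab' y)) (beta (lab' y)) (s (lab x)) (t (lab' y)) z.
have cg x y : continuous (g x y).
  exact: (continuous_monomial_weight (es (lab x)) (et (lab' y))).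
have tauE : (fun c' => tau N m n a alpha b beta (intervals r c') s t) =
    (fun c' => \det (M c')).
  apply/funext => c'.
  exact: (tau_det a alpha b beta blocks_m blocks_n (@compact_intervals R r c') es et).
have partialE i : (1 <= i <= 2 * r)%N ->
    partial i (fun c' => \det (M c')) c =
    \sum_x \sum_y ((-1) ^+ i * g x y (c i)) * cofactor (M c) x y.
  move=> ir.
  have dM x y : is_derive (c i) (1 : R) (fun h => M [eta c with i |-> h] x y)
      ((\matrix_(x, y) ((-1) ^+ i * g x y (c i))) x y).
    rewrite mxE (_ : (fun h => _) = (fun h =>
      \int[@lebesgue_measure R]_(z in intervals r [eta c with i |-> h]) g x y z)).
      exact: is_derive_Rintegral_intervals.
    by apply/funext => h; rewrite mxE.
  have := is_derive_det dM; rewrite update_id => dW.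
  rewrite /partial derive1E derive_val /det_deriv.
  by apply: eq_bigr => x _; apply: eq_bigr => y _; rewrite mxE.
rewrite /boundary_op tauE big_nat.
under eq_bigr => i ir do rewrite subrK partialE //.
rewrite -big_nat.
under eq_bigr do rewrite mulr_sumr.
rewrite exchange_big /=; apply: eq_bigr => x _.
under eq_bigr do rewrite mulr_sumr.
rewrite exchange_big /=; apply: eq_bigr => y _.
under eq_bigr do rewrite mulrA.
rewrite -mulr_suml; congr (_ * _).
have := boundary_moment (a (lab x)) (alpha (lab x)) (b (lab' y)) (beta (lab' y))
  (es (lab x)) (et (lab' y)) (e x + e' y + K)%N hc => <-.
by apply: eq_bigr => i _; rewrite /g -exprnP [in RHS]exprD; ring.
Qed.

(** Divides the term from differentiating [x ^+ (u + v + K)] between row, column and boundary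
    factor. Where a predecessor is truncated at 0, its coefficient is 0. *)
Lemma natr_mul_pred (R : pzRingType) (f : nat -> R) (u v K : nat) :
  (u + v + K)%:R * f (u + v + K).-1 =
  u%:R * f ((u + K).-1 + v)%N + v%:R * f (u + (v + K).-1)%N
  + K%:R * f (u + K.-1 + v)%N.
Proof.
rewrite !natrD !mulrDl; congr (_ + _ + _).
- by case: u => [|u]; rewrite ?mul0r //; congr (_ * f _); lia.
- by case: v => [|v]; rewrite ?mul0r //; congr (_ * f _); lia.
- by case: K => [|K]; rewrite ?mul0r //; congr (_ * f _); lia.
Qed.

Theorem theorem4p3 (R : realType) (p q N r : nat)
    (m : 'I_q -> nat) (n : 'I_p -> nat)
    (a alpha : 'I_q -> R) (b beta : 'I_p -> R)
    (c : nat -> R) (s : 'I_q -> nat -> R) (t : 'I_p -> nat -> R) (k : int)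
    (hp : (0 < p)%N) (hq : (0 < q)%N)
    (hm : forall i, (0 < m i)%N) (hn : forall j, (0 < n j)%N)
    (hmN : (\sum_(i < q) m i)%N = N) (hnN : (\sum_(j < p) n j)%N = N)
    (ha : \sum_(i < q) a i = 0) (hb : \sum_(j < p) b j = 0)
    (halpha : \sum_(i < q) alpha i = 0) (hbeta : \sum_(j < p) beta j = 0)
    (hc : forall i : nat, (1 <= i < 2 * r)%N -> c i < c i.+1)
    (hs : forall i, entire_times (s i)) (ht : forall j, entire_times (t j))
    (hk : -1 <= k) :
  boundary_op r k
    (fun c' => tau N m n a alpha b beta (intervals r c') s t) c
  = virasoro_op m n a alpha b beta k
      (tau N m n a alpha b beta (intervals r c)) s t.
Proof.
have [K kE] : exists K : nat, k = K%:Z - 1 by exists (absz (k + 1)); lia.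
have [lab [e [row [blocks_m lab_row exp_row row_onto]]]] := blocks_labels R hq hmN.
have [lab' [e' [row' [blocks_n lab_row' exp_row' row_onto']]]] := blocks_labels R hp hnN.
rewrite kE (boundary_tau a alpha b beta K blocks_m blocks_n hc hs ht) /virasoro_op.
rewrite (_ : K%:Z - 1 + 1 = K); last lia.
rewrite (_ : K%:Z - 1 + 2 = K.+1); last lia.
have cE := @compact_intervals R r c.
under [X in _ = X + _]eq_bigr => i _ do
  rewrite (virasoro_psi a alpha b beta blocks_m blocks_n cE hs ht K (lab_row i) (exp_row i) (row_onto i)).
under [X in _ = _ + X]eq_bigr => j _ do rewrite -pmulrn
  (virasoro_phi a alpha b beta blocks_m blocks_n cE hs ht K (lab_row' j) (exp_row' j) (row_onto' j)).
(* Summing over blocks and then over the rows of each block visits every row once. *)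
have regroup (T : finType) (f : 'I_N -> T) (X : T -> 'I_N -> R) :
    \sum_(i : T) \sum_(x | f x == i) X i x = \sum_x X (f x) x.
  rewrite (exchange_big_dep xpredT) //=; apply: eq_bigr => x _.
  by rewrite (big_pred1 (f x)) // => i; rewrite eq_sym.
rewrite !regroup [X in _ = _ + X]exchange_big -big_split /=; apply: eq_bigr => x _.
rewrite -big_split /=; apply: eq_bigr => y _.
(* The identity holds cofactor by cofactor; what remains is linear in the moments, which may be
   replaced by an arbitrary function of the exponent. *)
rewrite -mulrDl; congr (_ * _).
move: (block_moment _ _ _ _ _ _ _ (lab x) (lab' y)) => f.
move: (moment_diff _ _ _ _ _ _ _ (s _) _ _) (moment_diff _ _ _ _ _ _ _ (t _) _ _) => D D'.
rewrite natr_mul_pred.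
rewrite (_ : e x + K + e' y = e x + e' y + K)%N; last lia.
rewrite (_ : e x + K.+1 + e' y = (e x + e' y + K).+1)%N; last lia.
rewrite (_ : e x + (e' y + K) = e x + e' y + K)%N; last lia.
rewrite (_ : e x + (e' y + K.+1) = (e x + e' y + K).+1)%N; last lia.
by ring.
Qed.
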